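(* Let $d=2$ and let $k\ge0$ be an integer. The refined Scott–Zhang interpolation operator $Q_0:H^1(\Omega)\to V_0$ preserves the volume mass of order $k-1$ and the face mass of order $k$; that is, for every $v\in H^1(\Omega)$, $$\int_T(v-Q_0v)\,p\,dx=0\qquad\forall\,T\in\mathcal T_h,\ p\in P_{k-1}(T),$$ $$\int_E(v-Q_0v)\,p\,dx=0\qquad\forall\,E\in\mathcal E_h,\ p\in P_k(E).$$
   Context: $\Omega\subset\mathbb R^2$ is a bounded polygonal domain, $\mathcal T_h$ a (conforming) triangulation of $\Omega$, $\mathcal E_h$ the set of all edges of $\mathcal T_h$. $P_r$ denotes polynomials of total degree at most $r$ ($P_r=\{0\}$ if $r<0$). $V_0=\{v\in H^1(\Omega): v|_T\in P_{k+2}(T)\ \forall T\in\mathcal T_h\}$. $Q_0:H^1(\Omega)\to V_0$ is defined through values at the Lagrange nodes of the $C^0$-$P_{k+2}$ element: $Q_0v=\sum_{x_j}Q_0v(x_j)\phi_j$, with $\phi_j$ the Lagrange nodal basis. Nodes are classified as corner nodes (vertices), middle nodes (nodes in the interior of an edge) and internal nodes (nodes in the interior of a triangle). On a simplex $C$, the dual basis $\{\psi_j\}\subset P_{k+2}(C)$ of the Lagrange basis $\{\phi_j\}$ of $P_{k+2}(C)$ satisfies $\int_C\phi_j\psi_{j'}\,dx=\delta_{jj'}$. (1) For each corner node $c_j$ select one edge $C_j\in\mathcal E_h$ containing $c_j$, with $C_j\subset\partial\Omega$ if $c_j\in\partial\Omega$, and set $Q_0v(c_j)=\int_{C_j}\psi_jv\,dx$,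 where $\psi_j$ is the dual basis function on $C_j$ associated with $c_j$. (2) For each $E\in\mathcal E_h$, the values at the middle nodes of $E$ are the unique solution of $\int_E\big(\sum_{m\in E}Q_0v(m)\phi_m+\sum_{c\in E}Q_0v(c)\phi_c-v\big)p\,dx=0$ for all $p\in P_{k}(E)$ (sums over middle and corner nodes on $E$). (3) For each $T\in\mathcal T_h$, the values at the internal nodes of $T$ are the unique solution of $\int_T\big(\sum_{i}Q_0v(i)\phi_i+\sum_{m}Q_0v(m)\phi_m+\sum_{c}Q_0v(c)\phi_c-v\big)p\,dx=0$ for all $p\in P_{k-1}(T)$ (sums over internal, middle and corner nodes of $T$). *)

(* Defs.v *)
From HB Require Import structures.
From mathcomp Require Import all_boot all_order all_algebra.
From mathcomp Require Import all_classical all_reals all_analysis.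
Import Order.TTheory GRing.Theory Num.Theory.
Import numFieldNormedType.Exports.

Set Implicit Arguments.
Unset Strict Implicit.
Unset Printing Implicit Defensive.

Local Open Scope classical_set_scope.
Local Open Scope ring_scope.

Section Plane.
Context {R : realType}.
Implicit Types (f g v w : R * R -> R) (Omega D : set (R * R)).

Local Notation I01 := (`[0%R, 1%R]%classic : set R).

Definition leb2 := ((@lebesgue_measure R) \x (@lebesgue_measure R))%E.

Definition frontier Omega : set (R * R) := closure Omega `\` Omega°.

Definition seg_pt (a b : R * R) (t : R) : R * R := (1 - t) *: a + t *: b.

Definition seg (a b : R * R) : set (R * R) := seg_pt a b @` I01.

(* [Omega = (closure Omega)°] says that Omega lies on one side of its
   boundary, i.e. that there are no slits. *)
Definition polygonal_domain Omega : Prop :=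
  [/\ Omega !=set0, open Omega, connected Omega, bounded_set Omega &
      (closure Omega)° = Omega /\
      exists s : seq ((R * R) * (R * R)),
        frontier Omega = [set x | exists2 e, e \in s & seg e.1 e.2 x]].

(* The restriction of [f] to [D] is a polynomial of total degree at most [r];
   only f = 0 on D qualifies if r < 0. *)
Definition Pol (r : int) D f : Prop :=
  exists c : nat -> nat -> R, forall x, D x ->
    f x = \sum_(i < `|r|.+1) \sum_(j < `|r|.+1 | (i + j)%N%:Z <= r)
            c i j * x.1 ^+ i * x.2 ^+ j.

Fixpoint Cn (n : nat) f : Prop :=
  if n is n'.+1 then
    continuous f /\
    forall e : R * R, (forall x, derivable f x e) /\ Cn n' ('D_e f)
  else continuous f.

Definition smooth f : Prop := forall n, Cn n f.

Definition e1 : R * R := (1, 0).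
Definition e2 : R * R := (0, 1).

Definition test_function Omega f : Prop :=
  smooth f /\
  exists K, [/\ compact K, K `<=` Omega & forall x, ~ K x -> f x = 0].

Definition L2 Omega f : Prop :=
  measurable_fun Omega f /\
  leb2.-integrable Omega (fun x => ((f x) ^+ 2)%:E).

Definition weak_derivative Omega (e : R * R) v g : Prop :=
  forall f, test_function Omega f ->
    \int[leb2]_(x in Omega) (v x * 'D_e f x) =
    - \int[leb2]_(x in Omega) (g x * f x).

(* [G] is the weak gradient of the H^1 function [v]. *)
Definition H1_grad Omega v (G : (R * R -> R) * (R * R -> R)) : Prop :=
  [/\ L2 Omega v, L2 Omega G.1, L2 Omega G.2,
      weak_derivative Omega e1 v G.1 & weak_derivative Omega e2 v G.2].

(* Membership constrains the representative [v] on Omega only; its values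
   outside Omega, in particular on the boundary, are arbitrary. *)
Definition H1 Omega v : Prop := exists G, H1_grad Omega v G.

Definition L2_cvg Omega (u : nat -> R * R -> R) v : Prop :=
  (fun n => \int[leb2]_(x in Omega) ((u n x - v x) ^+ 2)%:E)%E @ \oo --> 0%E.

Definition H1_cvg Omega (u : nat -> R * R -> R) v : Prop :=
  exists2 G, H1_grad Omega v G &
    [/\ L2_cvg Omega u v,
        L2_cvg Omega (fun n => 'D_e1 (u n)) G.1 &
        L2_cvg Omega (fun n => 'D_e2 (u n)) G.2].

(* Euclidean length; the norm of [R * R] in the library is the sup norm. *)
Definition seg_length (a b : R * R) : R :=
  Num.sqrt ((b.1 - a.1) ^+ 2 + (b.2 - a.2) ^+ 2).

(* Arc length integral over the segment [a, b]. *)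
Definition seg_int (a b : R * R) f : R :=
  seg_length a b *
  \int[@lebesgue_measure R]_(t in I01) f (seg_pt a b t).

(* [w] is the trace on [a, b] of the H^1 function [v]: the L^2 limit of the
   restrictions to [a, b] of smooth functions converging to [v] in H^1. *)
Definition is_trace Omega (a b : R * R) v w : Prop :=
  [/\ measurable_fun I01 (w \o seg_pt a b),
      (@lebesgue_measure R).-integrable I01
        (fun t => ((w (seg_pt a b t)) ^+ 2)%:E) &
      exists u : nat -> R * R -> R,
        [/\ forall n, smooth (u n), H1_cvg Omega u v &
            (fun n => \int[@lebesgue_measure R]_(t in I01)
               ((u n (seg_pt a b t) - w (seg_pt a b t)) ^+ 2)%:E)%E
              @ \oo --> 0%E]].

End Plane.

Section Mesh.
Context {R : realType} {V : finType}.

(* Simplices are given by their sets of vertices. *)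
Definition hull (pos : V -> R * R) (S : {set V}) : set (R * R) :=
  [set x | exists l : V -> R, [/\ forall i, 0 <= l i, \sum_(i in S) l i = 1 &
                                  x = \sum_(i in S) l i *: pos i]].

Definition aff_indep (pos : V -> R * R) (S : {set V}) : Prop :=
  forall l : V -> R, \sum_(i in S) l i = 0 ->
    \sum_(i in S) l i *: pos i = 0 -> forall i, i \in S -> l i = 0.

Record triangulation (Omega : set (R * R)) := Triangulation {
  pos : V -> R * R;
  tris : {set {set V}};
  card_tri : forall T, T \in tris -> #|T| = 3%N;
  tri_nondegenerate : forall T, T \in tris -> aff_indep pos T;
  tri_conforming : forall T T', T \in tris -> T' \in tris ->
    hull pos T `&` hull pos T' = hull pos (T :&: T');
  tri_cover : closure Omega = \bigcup_(T in [set T | T \in tris]) hull pos T;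
  vertex_used : forall i, exists2 T, T \in tris & i \in T
}.

End Mesh.
Arguments triangulation {R} V Omega.

Section FiniteElement.
Context {R : realType} {V : finType} {Omega : set (R * R)}.
Variables (Th : triangulation V Omega) (k : nat).

Local Notation hull S := (hull (pos Th) S).

Definition edges : {set {set V}} :=
  [set E : {set V} | (#|E| == 2%N) && [exists T in tris Th, E \subset T]].

Definition edge_int (E : {set V}) (f : R * R -> R) : R :=
  if enum E is [:: a; b] then seg_int (pos Th a) (pos Th b) f else 0.

(* An edge integral is taken over E; a triangle integral is taken over the
   interior of T, since H^1 functions are unspecified on the boundary. *)
Definition tri_int (T : {set V}) (f : R * R -> R) : R :=
  \int[leb2]_(x in (hull T)°) f x.

(* By the trace theorem such a [w] exists for [v] in H^1 and every edge [E], and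
   it is unique up to equality almost everywhere on [E]. *)
Definition trace (v : R * R -> R) (E : {set V}) : R * R -> R :=
  xget (fun=> 0) [set w | exists a b,
    E = [set a; b]%SET /\ is_trace Omega (pos Th a) (pos Th b) v w].

Definition V0 (v : R * R -> R) : Prop :=
  H1 Omega v /\ forall T, T \in tris Th -> Pol k.+2 (hull T) v.

(* Multi-indices [j] with |j| = k + 2 stand for the points with barycentric
   coordinates j i / (k + 2). A node lies in the relative interior of the
   simplex spanned by its support. *)
Definition multi_index : finType := {ffun V -> 'I_k.+3}.
Implicit Types (i j : multi_index) (a : multi_index -> R).

Definition supp j : {set V} := [set l | j l != ord0].

Definition node_in (S : {set V}) j : bool :=
  (\sum_l (j l : nat) == k.+2)%N && (supp j \subset S).

Definition is_node j : bool := [exists T in tris Th, node_in T j].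

Definition corner (S : {set V}) j : bool := node_in S j && (#|supp j| == 1%N).
Definition middle (E : {set V}) j : bool := node_in E j && (supp j == E).
Definition internal (T : {set V}) j : bool := node_in T j && (supp j == T).

Definition node_pt j : R * R :=
  \sum_l ((j l : nat)%:R / k.+2%:R) *: pos Th l.

(* The Lagrange nodal basis of V_0. *)
Definition phi j : R * R -> R :=
  xget (fun=> 0) [set f | V0 f /\
    forall i, is_node i -> f (node_pt i) = (i == j)%:R].

(* The restrictions to E of the [phi i], for i a node on E, form the Lagrange
   basis of P_{k+2}(E). *)
Definition psi (E : {set V}) j : R * R -> R :=
  xget (fun=> 0) [set g | Pol k.+2 (hull E) g /\
    forall i, node_in E i -> edge_int E (fun x => phi i x * g x) = (i == j)%:R].

Definition edge_selection (C : multi_index -> {set V}) : Prop :=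
  forall j, is_node j -> #|supp j| = 1%N ->
    [/\ C j \in edges, supp j \subset C j &
        frontier Omega (node_pt j) -> hull (C j) `<=` frontier Omega].

Variables (C : multi_index -> {set V}) (v : R * R -> R).

Definition corner_val j : R :=
  edge_int (C j) (fun x => psi (C j) j x * trace v (C j) x).

(* Only the values at the nodes with support [E] (resp. [T] below) are
   determined. *)
Definition middle_sol (E : {set V}) : multi_index -> R :=
  xget (fun=> 0) [set a | forall p, Pol k (hull E) p ->
    edge_int E (fun x =>
      (\sum_(m | middle E m) a m * phi m x
       + \sum_(c | corner E c) corner_val c * phi c x
       - trace v E x) * p x) = 0].

Definition middle_val j : R := middle_sol (supp j) j.

Definition internal_sol (T : {set V}) : multi_index -> R :=
  xget (fun=> 0) [set a | forall p, Pol (k%:Z - 1) (hull T) p ->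
    tri_int T (fun x =>
      (\sum_(i | internal T i) a i * phi i x
       + \sum_(m | node_in T m && (#|supp m| == 2%N)) middle_val m * phi m x
       + \sum_(c | corner T c) corner_val c * phi c x
       - v x) * p x) = 0].

Definition internal_val j : R := internal_sol (supp j) j.

Definition nodal_val j : R :=
  if #|supp j| == 1%N then corner_val j
  else if #|supp j| == 2%N then middle_val j
  else internal_val j.

Definition Q0 : R * R -> R := fun x => \sum_(j | is_node j) nodal_val j * phi j x.

End FiniteElement.

(* Main.v *)
(* The identities hold by construction of the middle and internal nodal values,
   once (i) the nodal basis exists in V_0, (ii) it vanishes on the simplices not
   containing the node, and (iii) the linear systems defining the nodal values
   are solvable.

   (i) The Lagrange functions are products of hat functions.  They belong to
   H^1 because, for a piecewise polynomial f and a test function phi, f * phi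
   is Lipschitz along lines: its difference quotients have integral zero by
   translation invariance and converge almost everywhere and boundedly, so the
   integral of its piecewise derivative is zero.

   (ii) is the unisolvence of the principal lattice.

   (iii) Let b be the product of the barycentric coordinates of the simplex S.
   The weighted projection onto P_r(S) yields q in P_r(S) such that b * q - g is
   orthogonal to P_r(S); the nodal values of b * q at the nodes interior to S
   solve the system with right-hand side g. *)

Require Import Defs.
From HB Require Import structures.
From mathcomp Require Import all_boot all_order all_algebra.
From mathcomp Require Import all_classical all_reals all_analysis.
From mathcomp Require Import measurable_realfun.
From mathcomp Require Import zify ring lra.
Import Order.TTheory GRing.Theory Num.Theory.
Import numFieldNormedType.Exports.

Set Implicit Arguments.
Unset Strict Implicit.
Unset Printing Implicit Defensive.

Local Open Scope classical_set_scope.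
Local Open Scope ring_scope.

(** [phi], [middle_sol] and [internal_sol] are choices made by [xget], so the task is to show that
    the sets chosen from are inhabited; [xgetPex] then hands over the defining property. Edges and
    triangles share one argument: for unisolvence an edge is a triangle with a repeated vertex, and
    for the linear systems a simplex S comes with a map [gam] into its hull, which is the segment
    parametrisation on [0, 1] or the identity on the interior of T. The degrees of the test
    polynomials come from |S| + r = k + 2. Since b has degree |S|, the product b * q fits into the
    Lagrange space with r = k on an edge and r = k - 1 on a triangle. The monomials in two variables
    become linearly dependent on an edge, so their Gram matrix can be singular; the system is solved
    by checking that the right-hand side is compatible with the kernel. *)

(** * Functions that are polynomials of bounded total degree on a set *)

Section PolynomialFunctions.
Context {R : realType}.
Implicit Types (D : set (R * R)) (f g : R * R -> R) (p q : {poly {poly R}}).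

Definition peval p (x : R * R) : R := (p.[x.1%:P]).[x.2].

Definition tdeg_le (n : nat) p := forall i j, (n < i + j)%N -> p`_i`_j = 0.

Lemma peval_sum n p (x : R * R) : tdeg_le n p ->
  peval p x = \sum_(i < n.+1) \sum_(j < n.+1) p`_i`_j * x.1 ^+ i * x.2 ^+ j.
Proof.
move=> dp; have sp : (size p <= n.+1)%N.
  by apply/leq_sizeP => i ni; apply/polyP => j; rewrite coef0 dp//; lia.
rewrite /peval (horner_coef_wide _ sp) horner_sum; apply: eq_bigr => i _.
rewrite hornerM -rmorphXn /= hornerC (@horner_coef_wide _ n.+1); last first.
  by apply/leq_sizeP => j nj; rewrite dp//; lia.
by rewrite mulr_suml; apply: eq_bigr => j _; rewrite mulrAC.
Qed.

(** Replaces the coefficient table of [Pol] by an element of a polynomial ring, so that products and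
    division by a linear factor come from ring theory. Entries with i + j > n are cut off because
    [Pol] leaves them arbitrary. *)
Lemma PolP n D f : Pol n%:Z D f <->
  exists2 p, tdeg_le n p & forall x, D x -> f x = peval p x.
Proof.
split=> [[c cf]|[p dp pf]].
  pose p : {poly {poly R}} := \poly_(i < n.+1) \poly_(j < n.+1)
    (if (i + j <= n)%N then c i j else 0).
  have dp : tdeg_le n p.
    move=> i j nij; rewrite coef_poly; case: ifP => _; last by rewrite coef0.
    by rewrite coef_poly; case: ifP => // _; rewrite leqNgt nij.
  exists p => // x /cf ->; rewrite (peval_sum _ dp) absz_nat.
  apply: eq_bigr => i _; rewrite big_mkcond; apply: eq_bigr => j _.
  rewrite lez_nat coef_poly ltn_ord coef_poly ltn_ord.
  by case: ifP => // _; rewrite !mul0r.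
exists (fun i j => p`_i`_j) => x /pf ->.
rewrite (peval_sum _ dp) absz_nat; apply: eq_bigr => i _.
rewrite [RHS]big_mkcond; apply: eq_bigr => j _; rewrite lez_nat.
by case: ltnP => // /dp ->; rewrite !mul0r.
Qed.

Lemma tdeg_leD n p q : tdeg_le n p -> tdeg_le n q -> tdeg_le n (p + q).
Proof. by move=> dp dq i j nij; rewrite !coefD dp// dq// addr0. Qed.

Lemma tdeg_leM m n p q : tdeg_le m p -> tdeg_le n q -> tdeg_le (m + n) (p * q).
Proof.
move=> dp dq i j nij; rewrite coefM coef_sum big1// => -[a /= ai] _.
rewrite coefM big1// => -[b /= bj] _.
have [mab|] := ltnP m (a + b)%N; first by rewrite dp// mul0r.
by move=> abm; rewrite [q`__`__]dq ?mulr0//; lia.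
Qed.

Lemma eq_Pol n D f g : (forall x, D x -> f x = g x) -> Pol n D f -> Pol n D g.
Proof. by move=> fg [c cf]; exists c => x Dx; rewrite -fg// cf. Qed.

Lemma sub_Pol n D D' f : D' `<=` D -> Pol n D f -> Pol n D' f.
Proof. by move=> sD [c cf]; exists c => x /sD; exact: cf. Qed.

Lemma PolD (n : nat) D f g :
  Pol n D f -> Pol n D g -> Pol n D (fun x => f x + g x).
Proof.
move=> /PolP[p dp pf] /PolP[q dq qg]; apply/PolP; exists (p + q).
  exact: tdeg_leD.
by move=> x Dx; rewrite /peval !hornerD pf// qg.
Qed.

Lemma PolM (m n : nat) D f g :
  Pol m D f -> Pol n D g -> Pol (m + n)%N D (fun x => f x * g x).
Proof.
move=> /PolP[p dp pf] /PolP[q dq qg]; apply/PolP; exists (p * q).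
  exact: tdeg_leM.
by move=> x Dx; rewrite /peval !hornerM pf// qg.
Qed.

Lemma leq_Pol (m n : nat) D f : (m <= n)%N -> Pol m D f -> Pol n D f.
Proof.
move=> mn /PolP[p dp pf]; apply/PolP; exists p => // i j nij; apply: dp; lia.
Qed.

Lemma Pol_cst (n : nat) D (c : R) : Pol n D (fun=> c).
Proof.
apply/PolP; exists c%:P%:P; last by move=> x _; rewrite /peval !hornerC.
by move=> [|i] [|j]//= _; rewrite !coefC.
Qed.

Lemma PolZ (n : nat) D (c : R) f : Pol n D f -> Pol n D (fun x => c * f x).
Proof. by move=> /(PolM (Pol_cst 0 D c)). Qed.

Lemma PolN (n : nat) D f : Pol n D f -> Pol n D (fun x => - f x).
Proof. by move=> /(PolZ (-1)); apply: eq_Pol => x _; rewrite mulN1r. Qed.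

Lemma Pol_fst D : Pol 1 D fst.
Proof.
apply/(PolP 1); exists 'X; last by move=> x _; rewrite /peval hornerX hornerC.
move=> i j ij; rewrite coefX; case: eqP => [i1|_]; last by rewrite coef0.
by rewrite coefC; case: eqP => // j0; move: ij; rewrite i1 j0.
Qed.

Lemma Pol_snd D : Pol 1 D snd.
Proof.
apply/(PolP 1); exists 'X%:P; last by move=> x _; rewrite /peval hornerC hornerX.
move=> i j ij; rewrite coefC; case: eqP => [i0|_]; last by rewrite coef0.
by rewrite coefX; case: eqP => // j1; move: ij; rewrite i0 j1.
Qed.

Lemma Pol_sum (I : Type) (r : seq I) (P : pred I) (n : nat) D
    (F : I -> R * R -> R) :
  (forall i, P i -> Pol n D (F i)) ->
  Pol n D (fun x => \sum_(i <- r | P i) F i x).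
Proof.
move=> PF; elim: r => [|a r IH].
  by apply: eq_Pol (Pol_cst n D 0) => x _; rewrite big_nil.
case Pa : (P a); last by apply: eq_Pol IH => x _; rewrite big_cons Pa.
by apply: eq_Pol (PolD (PF _ Pa) IH) => x _; rewrite big_cons Pa.
Qed.

Lemma Pol_prod (I : Type) (r : seq I) (d : I -> nat) D (F : I -> R * R -> R) :
  (forall i, Pol (d i) D (F i)) ->
  Pol (\sum_(i <- r) d i)%N D (fun x => \prod_(i <- r) F i x).
Proof.
move=> PF; elim: r => [|a r IH].
  by apply: eq_Pol (Pol_cst _ D 1) => x _; rewrite big_nil.
rewrite big_cons.
by apply: eq_Pol (PolM (PF a) IH) => x _; rewrite big_cons.
Qed.

Lemma PolX (m n : nat) D f : Pol m D f -> Pol (n * m)%N D (fun x => f x ^+ n).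
Proof.
move=> Pf; have := @Pol_prod _ (index_iota 0 n) (fun=> m) D (fun=> f) (fun=> Pf).
rewrite big_const_nat iter_addn addn0 subn0 mulnC.
by apply: eq_Pol => x _; rewrite big_const_nat subn0 iter_mulr_1.
Qed.

(** A monomial of degree i + j pulls back to a product of i + j functions of degree at most 1, so
    affine substitution keeps the total degree. *)
Lemma Pol_comp (n : nat) D D' f (a b : R * R -> R) :
  Pol 1 D a -> Pol 1 D b -> (forall x, D x -> D' (a x, b x)) ->
  Pol n D' f -> Pol n D (fun x => f (a x, b x)).
Proof.
move=> Pa Pb DD' [c cf].
have H : Pol n D (fun x => \sum_(i < n.+1) \sum_(j < n.+1 | (i + j)%N%:Z <= n%:Z)
            c i j * a x ^+ i * b x ^+ j).
  apply: Pol_sum => i _; apply: Pol_sum => j; rewrite lez_nat => ij.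
  have := PolZ (c i j) (PolM (PolX i Pa) (PolX j Pb)); rewrite !muln1.
  by move/(leq_Pol ij); apply: eq_Pol => x _; rewrite mulrA.
by apply: eq_Pol H => x Dx; rewrite cf ?absz_nat//; exact: DD'.
Qed.

End PolynomialFunctions.

(** * Unisolvence of the principal lattice on the reference triangle *)

Section Unisolvence.
Context {R : realType}.

(* Newton's argument: divide by [Y - b 0] and shift the nodes [b]. *)
Lemma tdeg_le_lattice_eq0 n (p : {poly {poly R}}) (a b : nat -> R) :
  injective a -> injective b -> tdeg_le n p ->
  (forall i j, (i + j <= n)%N -> (p.[(b j)%:P]).[a i] = 0) -> p = 0.
Proof.
move=> inja; elim: n p b => [|n IH] p b injb dp p0.
  have pC : p = ((p`_0)`_0)%:P%:P.
    apply/polyP => i; apply/polyP => j; rewrite coefC; case: eqP => [->|i0].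
      by rewrite coefC; case: eqP => [->//|j0]; rewrite dp//; lia.
    by rewrite coef0 dp//; lia.
  by have := p0 0%N 0%N isT; rewrite pC !hornerC => ->.
(* On the line where the outer variable equals [b 0], p is a univariate polynomial of degree at most
   n + 1 with the n + 2 zeros [a 0], ..., [a n.+1]. *)
have r0 : root p (b 0%N)%:P.
  apply/eqP; apply: (@roots_geq_poly_eq0 _ _ [seq a i | i <- iota 0 n.+2]).
  - by apply/allP => x /mapP[i]; rewrite mem_iota => ij ->; apply/eqP/p0; lia.
  - by rewrite map_inj_uniq// iota_uniq.
  - rewrite size_map size_iota; apply/leq_sizeP => j nj.
    rewrite (@horner_coef_wide _ n.+2); last first.
      by apply/leq_sizeP => i ni; apply/polyP => l; rewrite coef0 dp//; lia.
    rewrite coef_sum big1// => i _; rewrite -rmorphXn coefMC dp ?mul0r//; lia.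
have [q pq] := factor_theorem _ _ r0.
(* Comparing coefficients, p_(i+1) = q_i - b_0 q_(i+1); hence the degree bound for q follows by
   descending induction on i, starting from the size of q. *)
have dq : tdeg_le n q.
  move=> i j; have [m] := ubnP (size q - i).
  elim: m i j => // m IHm i j sqi nij.
  have [sq|iq] := leqP (size q) i; first by rewrite [q`_i]nth_default// coef0.
  have : p`_i.+1`_j = 0 by apply: dp; lia.
  rewrite pq mulrBr coefB coefMX/= coefMC coefB coefMC.
  rewrite (IHm i.+1 j); [|lia|lia].
  by rewrite mul0r subr0.
suff q0 : q = 0 by rewrite pq q0 mul0r.
apply: (IH _ (b \o S)) => //.
  by move=> i j /= /injb [].
move=> i j ij /=; have := p0 i j.+1; rewrite pq hornerM hornerXsubC -polyCB.
rewrite hornerM hornerC addnS ltnS => /(_ ij)/eqP.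
by rewrite mulf_eq0 subr_eq0 => /orP[/eqP //|/eqP/injb].
Qed.

Lemma Pol_lattice_eq0 n (f : R * R -> R) : Pol n.+1%N [set: R * R] f ->
  (forall i j, (i + j <= n.+1)%N -> f (i%:R / n.+1%:R, j%:R / n.+1%:R) = 0) ->
  forall x, f x = 0.
Proof.
move=> /PolP[p dp pf] f0 x; rewrite pf// /peval.
suff -> : p = 0 by rewrite !hornerC.
have inj : injective (fun i : nat => i%:R / n.+1%:R : R).
  by move=> i j /(divIf (lt0r_neq0 (ltr0Sn R n)))/eqP; rewrite eqr_nat => /eqP.
apply: (tdeg_le_lattice_eq0 inj inj dp) => i j ij.
(* [peval] substitutes the first coordinate for the outer variable, to which the nodes [b] belong;
   hence i and j are exchanged. *)
by rewrite -[LHS](pf (j%:R / n.+1%:R, i%:R / n.+1%:R))// f0// addnC.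
Qed.

End Unisolvence.

(** * Barycentric coordinates of a triangle and of its faces *)

Section Barycentric.
Context {R : realType} {V : finType}.
Implicit Types (pos : V -> R * R) (S T : {set V}) (x : R * R).

Definition affine_fun (f : R * R -> R) :=
  exists a b c, forall x, f x = a + b * x.1 + c * x.2.

(* The affine extensions of the barycentric coordinates with respect to the
   triangle [T], set to zero at the vertices of the mesh outside [T]. *)
Definition barycentric pos T (beta : V -> R * R -> R) : Prop :=
  [/\ forall l, affine_fun (beta l),
      forall l x, l \notin T -> beta l x = 0,
      forall x, \sum_(l in T) beta l x = 1 &
      forall x, \sum_(l in T) beta l x *: pos l = x].

(** The determinant of two plane vectors, twice the signed area of the triangle they span. *)
Definition cross (u v : R * R) : R := u.1 * v.2 - u.2 * v.1.

Lemma pair_ext (u v : R * R) : u.1 = v.1 -> u.2 = v.2 -> u = v.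
Proof. by case: u v => [? ?] [? ?] /= -> ->. Qed.

Lemma affine_fun_Pol D (f : R * R -> R) : affine_fun f -> Pol 1 D f.
Proof.
move=> [a [b [c fE]]].
have := PolD (PolD (Pol_cst 1 D a) (PolZ b (Pol_fst D))) (PolZ c (Pol_snd D)).
by apply: eq_Pol => x _; rewrite fE.
Qed.

Lemma sum_enum3 (W : zmodType) T (a b c : V) (F : V -> W) :
  enum T = [:: a; b; c] -> \sum_(i in T) F i = F a + F b + F c.
Proof. by move=> eT; rewrite -big_enum eT !big_cons big_nil /= addr0 addrA. Qed.

(** If the determinant of the edge vectors u and w vanished, then w.1 u - u.1 w and w.2 u - u.2 w
    would both be zero. Affine independence makes all these coefficients zero, so u = 0, which is
    itself a nontrivial relation. *)
Lemma cross_neq0 pos T (a b c : V) : enum T = [:: a; b; c] ->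
  aff_indep pos T -> cross (pos b - pos a) (pos c - pos a) != 0.
Proof.
move=> eT aff; apply/eqP => cr0.
have := enum_uniq T; rewrite eT /= !inE !negb_or => /and3P[/andP[ab ac] bc _].
have ba : b != a by rewrite eq_sym. have ca : c != a by rewrite eq_sym.
have cb : c != b by rewrite eq_sym.
have bT : b \in T by rewrite -mem_enum eT !inE eqxx orbT.
have cT : c \in T by rewrite -mem_enum eT !inE eqxx !orbT.
have dep (s t : R) : s *: (pos b - pos a) + t *: (pos c - pos a) = 0 ->
    s = 0 /\ t = 0.
  move=> st0; pose l i := if i == a then - s - t else if i == b then s else t.
  have la : l a = - s - t by rewrite /l eqxx.
  have lb : l b = s by rewrite /l (negbTE ba) eqxx.
  have lc : l c = t by rewrite /l (negbTE ca) (negbTE cb).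
  have l0 : forall i, i \in T -> l i = 0.
    apply: aff; rewrite (sum_enum3 _ eT) la lb lc; first by ring.
    by rewrite -[RHS]st0; apply: pair_ext; rewrite /= /GRing.scale /=; ring.
  by rewrite -{1}lb -lc !l0.
set u := pos b - pos a in cr0 dep; set w := pos c - pos a in cr0 dep.
have cr : u.1 * w.2 = u.2 * w.1 by apply/eqP; rewrite -subr_eq0; apply/eqP.
have [w10 u10] : w.1 = 0 /\ - u.1 = 0.
  by apply: dep; apply: pair_ext; rewrite /= /GRing.scale /=;
    move: cr; rewrite /u /w /=; lra.
have [w20 u20] : w.2 = 0 /\ - u.2 = 0.
  by apply: dep; apply: pair_ext; rewrite /= /GRing.scale /=;
    move: cr; rewrite /u /w /=; lra.
have [] : (1 : R) = 0 /\ (0 : R) = 0; last by move/eqP; rewrite oner_eq0.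
apply: dep; rewrite scale0r addr0 scale1r.
by apply: pair_ext; apply: oppr_inj; rewrite oppr0.
Qed.

(** Cramer's rule: the coordinate at a vertex is the signed area of the triangle formed by x and the
    opposite edge, divided by the signed area of T. *)
Lemma barycentric_exists pos T : #|T| = 3%N -> aff_indep pos T ->
  exists beta, barycentric pos T beta.
Proof.
move=> T3 aff; have [a [b [c eT]]] : exists a b c, enum T = [:: a; b; c].
  move: T3; rewrite cardE; case: (enum T) => [|a [|b [|c [|]]]]// _.
  by exists a, b, c.
have := cross_neq0 eT aff; set d := cross _ _ => d0.
have := enum_uniq T; rewrite eT /= !inE !negb_or => /and3P[/andP[ab ac] bc _].
have ba : b != a by rewrite eq_sym. have ca : c != a by rewrite eq_sym.
have cb : c != b by rewrite eq_sym.
pose aff3 (p q : R * R) x := cross (p - x) (q - x) / d.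
have aff3P p q : affine_fun (aff3 p q).
  exists ((p.1 * q.2 - p.2 * q.1) / d), ((p.2 - q.2) / d), ((q.1 - p.1) / d).
  by move=> x; rewrite /aff3 /cross /=; ring.
pose beta l := if l == a then aff3 (pos b) (pos c)
  else if l == b then aff3 (pos c) (pos a)
  else if l == c then aff3 (pos a) (pos b) else fun=> 0.
have be_a : beta a = aff3 (pos b) (pos c) by rewrite /beta eqxx.
have be_b : beta b = aff3 (pos c) (pos a) by rewrite /beta (negbTE ba) eqxx.
have be_c : beta c = aff3 (pos a) (pos b).
  by rewrite /beta (negbTE ca) (negbTE cb) eqxx.
exists beta; split.
- move=> l; rewrite /beta; do 3?case: ifP => _ //.
  by exists 0, 0, 0 => x; ring.
- by move=> l x; rewrite -mem_enum eT !inE !negb_or /beta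
    => /and3P[/negbTE-> /negbTE-> /negbTE->].
- move=> x; rewrite (sum_enum3 _ eT) be_a be_b be_c /aff3 /cross /=.
  by apply: (mulIf d0); rewrite !mulrDl !mulfVK// /d /cross /=; ring.
- move=> x; rewrite (sum_enum3 _ eT) be_a be_b be_c.
  apply: pair_ext; rewrite /= /GRing.scale /= /aff3; apply: (mulIf d0).
    by rewrite !mulrDl ![_ / d * _]mulrAC !mulfK// /d /cross /=; ring.
  by rewrite !mulrDl ![_ / d * _]mulrAC !mulfK// /d /cross /=; ring.
Qed.

End Barycentric.

Section Hull.
Context {R : realType} {V : finType}.
Variables (pos : V -> R * R) (T : {set V}) (beta : V -> R * R -> R).
Hypotheses (aff : aff_indep pos T) (bary : barycentric pos T beta).
Implicit Types (S : {set V}) (x : R * R) (l : V -> R).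

Lemma barycentric_unique l x : \sum_(i in T) l i = 1 ->
  \sum_(i in T) l i *: pos i = x -> forall i, i \in T -> beta i x = l i.
Proof.
case: bary => _ _ b1 bx l1 lx i iT; apply/eqP; rewrite -subr_eq0; apply/eqP.
apply: (aff _ _ iT (l := fun i => beta i x - l i)).
  by rewrite sumrB b1 l1 subrr.
under eq_bigr do rewrite scalerBl.
by rewrite sumrB bx lx subrr.
Qed.

Lemma big_subset_eq0 (W : zmodType) S (F : V -> W) : S \subset T ->
  (forall i, i \in T -> i \notin S -> F i = 0) ->
  \sum_(i in T) F i = \sum_(i in S) F i.
Proof.
move=> ST F0; rewrite (big_setID S) /= (finset.setIidPr ST) [X in _ + X]big1 ?addr0//.
by move=> i; rewrite inE => /andP[iS iT]; exact: F0.
Qed.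

Lemma barycentric_comb S l x : S \subset T -> \sum_(i in S) l i = 1 ->
  x = \sum_(i in S) l i *: pos i ->
  forall i, beta i x = if i \in S then l i else 0.
Proof.
move=> ST l1 lx i; have [iT|iT] := boolP (i \in T); last first.
  case: bary => _ -> // _ _; case: ifP => // iS.
  by rewrite (fintype.subsetP ST _ iS) in iT.
pose m i := if i \in S then l i else 0.
apply: (@barycentric_unique m) => //.
  rewrite (big_subset_eq0 ST) => [|j _ /negbTE jS]; last by rewrite /m jS.
  by rewrite -l1; apply: eq_bigr => j jS; rewrite /m jS.
rewrite (big_subset_eq0 ST) => [|j _ /negbTE jS]; last by rewrite /m jS scale0r.
by rewrite lx; apply: eq_bigr => j jS; rewrite /m jS.
Qed.

Lemma hull_subE S x : S \subset T -> hull pos S x <->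
  (forall i, 0 <= beta i x) /\ (forall i, i \notin S -> beta i x = 0).
Proof.
move=> ST; split=> [[l [l0 l1 lx]]|[b0 bS]].
  have H := barycentric_comb ST l1 lx; split=> i; rewrite H; first by case: ifP.
  by move=> /negbTE->.
case: bary => _ _ b1 bx; exists (fun i => beta i x); split=> //.
  by rewrite -(big_subset_eq0 ST) ?b1// => i _ /bS.
by rewrite -(big_subset_eq0 ST) ?bx// => i _ /bS ->; rewrite scale0r.
Qed.

Lemma hullE x : hull pos T x <-> (forall i, 0 <= beta i x).
Proof.
split=> [/(hull_subE x (fintype.subxx T))[]//|b0].
by apply/(hull_subE x (fintype.subxx T)); split=> // i; case: bary => _ + _ _; exact.
Qed.

Lemma barycentric_vertex i j : j \in T -> beta i (pos j) = (i == j)%:R.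
Proof.
move=> jT; rewrite (@barycentric_comb [set j]%SET (fun=> 1)) ?inE ?finset.sub1set//.
- by case: eqP.
- by rewrite big_set1.
- by rewrite big_set1 scale1r.
Qed.

End Hull.

(** * Hat functions of the mesh *)

Section MeshCoordinates.
Context {R : realType} {V : finType} {Omega : set (R * R)}.
Variable Th : triangulation V Omega.
Local Notation hull := (hull (pos Th)).

Lemma mesh_barycentric : exists beta : {set V} -> V -> R * R -> R,
  forall T, T \in tris Th -> barycentric (pos Th) T (beta T).
Proof.
have /choice[beta H] : forall T : {set V}, exists b,
    T \in tris Th -> barycentric (pos Th) T b.
  move=> T; have [TT|_] := boolP (T \in tris Th); last by exists (fun _ _ => 0).
  have [b Hb] := barycentric_exists (card_tri TT) (tri_nondegenerate TT).
  by exists b.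
by exists beta.
Qed.

(** A common point is a convex combination of the common vertices alone, and its weights, extended
    by zero, are its coordinates in either triangle. *)
Lemma barycentric_conforming (beta : {set V} -> V -> R * R -> R) T T' x :
  (forall T, T \in tris Th -> barycentric (pos Th) T (beta T)) ->
  T \in tris Th -> T' \in tris Th -> hull T x -> hull T' x ->
  beta T ^~ x = beta T' ^~ x.
Proof.
move=> Hb TT TT' Tx T'x.
have : hull (T :&: T') x by rewrite -(tri_conforming TT TT').
move=> [l [l0 l1 lx]]; apply/funext => i.
rewrite (barycentric_comb (tri_nondegenerate TT) (Hb _ TT) _ l1 lx) ?finset.subsetIl//.
by rewrite (barycentric_comb (tri_nondegenerate TT') (Hb _ TT') _ l1 lx) ?finset.subsetIr.
Qed.

(* By conformity, the coordinates with respect to two triangles agree on their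
   intersection, so that they glue to the hat functions of the mesh. *)
Lemma mesh_hat (beta : {set V} -> V -> R * R -> R) :
  (forall T, T \in tris Th -> barycentric (pos Th) T (beta T)) ->
  exists Lam : V -> R * R -> R,
    forall T x i, T \in tris Th -> hull T x -> Lam i x = beta T i x.
Proof.
move=> Hb; pose P x := xget finset.set0 [set T | T \in tris Th /\ hull T x].
exists (fun i x => beta (P x) i x) => T x i TT Tx.
have [PT Px] : P x \in tris Th /\ hull (P x) x.
  by apply: (@xgetPex _ finset.set0 [set T | T \in tris Th /\ hull T x]); exists T.
by have /(congr1 (@^~ i)) := barycentric_conforming Hb PT TT Px Tx.
Qed.

End MeshCoordinates.

(** * Lagrange nodes and unisolvence on edges and triangles *)

Section LagrangeNodes.
Context {R : realType} {V : finType} {Omega : set (R * R)}.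
Variables (Th : triangulation V Omega) (k : nat).
Local Notation hull := (hull (pos Th)).
Implicit Types (S T : {set V}) (j m : multi_index (V := V) k) (f : R * R -> R).

Lemma node_sum S j : node_in S j -> \sum_(l in S) (j l)%:R / k.+2%:R = 1 :> R.
Proof.
move=> /andP[/eqP js sj]; rewrite -mulr_suml -natr_sum.
suff e : (\sum_(l in S) j l)%N = k.+2.
  have -> : (\sum_(l in S) j l)%:R = k.+2%:R :> R by rewrite e.
  by rewrite divff.
rewrite -[RHS]js [RHS](bigID [in S]) /= [X in (_ + X)%N]big1 ?addn0// => l lS.
apply/eqP; apply: contraNT lS => jl; apply: (fintype.subsetP sj).
by rewrite inE; apply: contraNneq jl => ->.
Qed.

Lemma node_pt_sum S j : node_in S j ->
  node_pt Th j = \sum_(l in S) ((j l)%:R / k.+2%:R) *: pos Th l.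
Proof.
move=> /andP[_ sj]; rewrite /node_pt [LHS](bigID [in S]) /=.
rewrite [X in _ + X]big1 ?addr0// => l lS.
have -> : j l = ord0; last by rewrite mul0r scale0r.
apply/eqP; apply: contraNT lS => jl; apply: (fintype.subsetP sj).
by rewrite inE.
Qed.

Lemma node_pt_hull S j : node_in S j -> hull S (node_pt Th j).
Proof.
move=> nj; exists (fun l => (j l)%:R / k.+2%:R); split=> //.
- exact: node_sum.
- exact: node_pt_sum.
Qed.

Lemma sub_hull S T : S \subset T -> hull S `<=` hull T.
Proof.
move=> ST x [l [l0 l1 lx]]; exists (fun i => if i \in S then l i else 0); split.
- by move=> i; case: ifP.
- rewrite (@big_subset_eq0 _ T _ S)//; last by move=> i _ /negbTE ->.
  by rewrite -l1; apply: eq_bigr => i ->.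
- rewrite (@big_subset_eq0 _ T _ S)//; last by move=> i _ /negbTE ->; rewrite scale0r.
  by rewrite lx; apply: eq_bigr => i ->.
Qed.

Lemma node_inS S T j : S \subset T -> node_in S j -> node_in T j.
Proof. by move=> ST /andP[js sj]; rewrite /node_in js (fintype.subset_trans sj ST). Qed.

Let param (a b c : V) (s : R * R) : R * R :=
  (1 - s.1 - s.2) *: pos Th a + s.1 *: pos Th b + s.2 *: pos Th c.

(** For an edge the third vertex repeats the first one, so that a single lattice argument serves
    both dimensions. *)
Lemma hull_param S : #|S| = 2%N \/ #|S| = 3%N ->
  exists a b c, [/\ a \in S, b \in S, c \in S &
    forall x, hull S x -> exists s, x = param a b c s].
Proof.
rewrite cardE => Scard.
case eS : (enum S) Scard => [|a [|b [|c [|]]]] Scard //; try by case: Scard.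
  have aS : a \in S by rewrite -mem_enum eS !inE eqxx.
  have bS : b \in S by rewrite -mem_enum eS !inE eqxx orbT.
  exists a, b, a; split=> // y [l [_ l1 ->]]; exists (l b, 0).
  rewrite /param -big_enum eS !big_cons big_nil /= scale0r !addr0 subr0.
  by rewrite -l1 -big_enum eS !big_cons big_nil /= addr0 addrK.
have aS : a \in S by rewrite -mem_enum eS !inE eqxx.
have bS : b \in S by rewrite -mem_enum eS !inE eqxx orbT.
have cS : c \in S by rewrite -mem_enum eS !inE eqxx !orbT.
exists a, b, c; split=> // y [l [_ l1 ->]]; exists (l b, l c).
rewrite /param (sum_enum3 _ eS) -l1 (sum_enum3 _ eS) /=.
by congr (_ *: _ + _ + _); ring.
Qed.

Lemma lattice_node S a b c (i j : nat) : a \in S -> b \in S -> c \in S ->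
  (i + j <= k.+2)%N -> exists2 m : multi_index (V := V) k, node_in S m &
    node_pt Th m = param a b c (i%:R / k.+2%:R, j%:R / k.+2%:R).
Proof.
move=> aS bS cS ij; pose n := (k.+2 - i - j)%N.
(* The three weights are added, so that the formula stays correct when a, b and c are not distinct,
   as happens on an edge. *)
pose w l := (n * (l == a) + i * (l == b) + j * (l == c))%N.
have delta (W : zmodType) (F : V -> W) d :
    \sum_l F l *+ (l == d) = F d.
  rewrite (bigD1 d)//= eqxx big1 ?addr0// => l /negbTE ->.
  by rewrite mulr0n.
have sw : (\sum_l w l = k.+2)%N.
  have dn d : (\sum_l (l == d) = 1)%N.
    by rewrite (bigD1 d)//= eqxx big1 ?addn0// => l /negbTE ->.
  by rewrite !big_split /= -!big_distrr /= !dn !muln1 /n; lia.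
have wk l : (w l < k.+3)%N by rewrite ltnS -sw (bigD1 l)//= leq_addr.
pose m : multi_index (V := V) k := [ffun l => Ordinal (wk l)].
exists m.
  rewrite /node_in; apply/andP; split.
    by rewrite -[X in _ == X]sw; apply/eqP; apply: eq_bigr => l _; rewrite ffunE.
  apply/fintype.subsetP => l; rewrite inE ffunE -val_eqE /= /w.
  have [->//|_] := eqVneq l a; have [->//|_] := eqVneq l b.
  by have [->//|_] := eqVneq l c; rewrite !muln0.
rewrite /node_pt /param /=.
have k0 : k.+2%:R != 0 :> R by rewrite pnatr_eq0.
have -> : 1 - i%:R / k.+2%:R - j%:R / k.+2%:R = n%:R / k.+2%:R :> R.
  rewrite /n -subnDA natrB// natrD; field.
  by rewrite -(natrD _ 2) pnatr_eq0.
transitivity (\sum_l ((n%:R / k.+2%:R) *: pos Th l) *+ (l == a) +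
    \sum_l ((i%:R / k.+2%:R) *: pos Th l) *+ (l == b) +
    \sum_l ((j%:R / k.+2%:R) *: pos Th l) *+ (l == c)); last by rewrite !delta.
rewrite -!big_split /=; apply: eq_bigr => l _; rewrite ffunE /= /w.
by do 3!case: eqP => _;
  rewrite ?muln1 ?muln0 ?addn0 ?add0n ?natrD ?mulrDl ?mulr1n ?mulr0n ?scalerDl
    ?addr0 ?add0r ?mul0r ?scale0r.
Qed.

Lemma unisolvent S f : #|S| = 2%N \/ #|S| = 3%N -> Pol k.+2 (hull S) f ->
  (forall j, node_in S j -> f (node_pt Th j) = 0) ->
  forall x, hull S x -> f x = 0.
Proof.
move=> Scard [co cof] f0 x Sx.
have [a [b [c [aS bS cS cov]]]] := hull_param Scard.
(* The lattice argument needs a polynomial on the whole plane, whereas f is controlled on the hull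
   only; g is its polynomial extension. *)
pose g (y : R * R) := \sum_(i < k.+3) \sum_(j < k.+3 | (i + j)%N%:Z <= k.+2)
            co i j * y.1 ^+ i * y.2 ^+ j.
have Pg : Pol k.+2 setT g by exists co.
have fg y : hull S y -> f y = g y by exact: cof.
have aff1 (u v w : R) : Pol 1 [set: R * R]
    (fun s : R * R => (1 - s.1 - s.2) * u + s.1 * v + s.2 * w).
  apply: affine_fun_Pol; exists u, (v - u), (w - u) => s; ring.
have Pg' : Pol k.+2 setT (fun s => g (param a b c s)).
  have := Pol_comp (aff1 (pos Th a).1 (pos Th b).1 (pos Th c).1)
    (aff1 (pos Th a).2 (pos Th b).2 (pos Th c).2) (fun _ _ => I) Pg.
  by apply: eq_Pol.
have [s xs] := cov _ Sx; rewrite fg// xs.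
apply: (Pol_lattice_eq0 Pg') => i j ij /=.
have [m Sm <-] := lattice_node aS bS cS ij.
by rewrite -fg ?f0//; exact: node_pt_hull.
Qed.

End LagrangeNodes.

(** * The Lagrange basis and nodal interpolation *)

Section LagrangeBasis.
Context {R : realType} {V : finType} {Omega : set (R * R)}.
Variables (Th : triangulation V Omega) (k : nat).
Local Notation hull := (hull (pos Th)).
Implicit Types (S T : {set V}) (i j : multi_index (V := V) k) (f : R * R -> R).

Lemma barycentric_node T beta i l : T \in tris Th ->
  barycentric (pos Th) T beta -> node_in T i ->
  beta l (node_pt Th i) = (i l)%:R / k.+2%:R.
Proof.
move=> TT bT iT; rewrite (barycentric_comb (tri_nondegenerate TT) bT
  (fintype.subxx T) (node_sum iT) (node_pt_sum Th iT)).
case: ifPn => // lT; have -> : i l = ord0; last by rewrite mul0r.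
apply/eqP; apply: contraNT lT => il; case/andP: iT => _ /fintype.subsetP; apply.
by rewrite inE.
Qed.

(** The factor belonging to l has zeros where the l-th lattice coordinate is 0, ..., j l - 1. As i
    and j both sum to k + 2, some i l is smaller than j l whenever i differs from j. Built from hat
    functions, the product is a single function that is polynomial on each triangle. *)
Lemma lagrange_exists j : (\sum_l (j l : nat))%N = k.+2 ->
  exists2 f, forall T, T \in tris Th -> Pol k.+2 (hull T) f &
    forall i, is_node Th i -> f (node_pt Th i) = (i == j)%:R.
Proof.
move=> js; have [beta Hb] := mesh_barycentric Th.
have [Lam HL] := mesh_hat Hb.
pose F (Lm : V -> R * R -> R) x := \prod_l \prod_(s < j l)
  ((k.+2%:R * Lm l x - s%:R) / ((j l)%:R - s%:R)).
exists (F Lam) => [T TT|i /exists_inP[T TT iT]].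
  have : Pol k.+2 (hull T) (F (beta T)).
    rewrite -{1}js; apply: Pol_prod => l.
    have [/(_ l) al _ _ _] := Hb _ TT.
    have Pl (s : 'I_(j l)) : Pol 1 (hull T)
        (fun x => (k.+2%:R * beta T l x - s%:R) / ((j l)%:R - s%:R)).
      have := PolD (PolZ k.+2%:R (affine_fun_Pol (hull T) al))
                   (Pol_cst 1 (hull T) (- s%:R)).
      by move=> /(PolZ ((j l)%:R - s%:R)^-1); apply: eq_Pol => x _; rewrite mulrC.
    by have := Pol_prod (index_enum 'I_(j l)) Pl; rewrite sum1_card card_ord.
  apply: eq_Pol => x Tx; apply: eq_bigr => l _; apply: eq_bigr => s _.
  by rewrite (HL _ _ _ TT Tx).
have Lami l : k.+2%:R * Lam l (node_pt Th i) = (i l)%:R.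
  rewrite (HL _ _ _ TT (node_pt_hull Th iT)) (barycentric_node l TT (Hb _ TT) iT).
  by rewrite mulrC divfK.
rewrite /F; have [ij|ij] := eqVneq i j.
  apply: big1 => l _; apply: big1 => s _; rewrite Lami.
  have -> : (i l)%:R = (j l)%:R :> R by rewrite ij.
  by rewrite divff// subr_eq0 eqr_nat gtn_eqF.
have [l il] : exists l, (i l < j l)%N.
  apply/existsP; apply: contraNT ij => /existsPn ji; apply/eqP.
  have : (\sum_l (i l - j l) = 0)%N.
    rewrite sumnB => [|l _]; last by rewrite leqNgt ji.
    by case/andP: iT => /eqP -> _; rewrite js subnn.
  move/eqP; rewrite sum_nat_eq0 => /forallP ij0; apply/ffunP => l; apply/val_inj.
  by apply/eqP; rewrite /= eqn_leq -subn_eq0 leqNgt ji andbT; have := ij0 l.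
by rewrite (bigD1 l)//= (bigD1 (Ordinal il))//= Lami subrr !mul0r.
Qed.

Variable ph : multi_index (V := V) k -> R * R -> R.
Hypothesis phPol : forall j T, is_node Th j -> T \in tris Th ->
  Pol k.+2 (hull T) (ph j).
Hypothesis ph_node : forall i j, is_node Th i -> is_node Th j ->
  ph j (node_pt Th i) = (i == j)%:R.

Lemma node_in_is_node S T j : T \in tris Th -> S \subset T -> node_in S j ->
  is_node Th j.
Proof. by move=> TT ST jS; apply/exists_inP; exists T => //; exact: node_inS jS. Qed.

(** Every node of S differs from j, so [ph j] vanishes at all of them and unisolvence on S applies.
    The family [ph] is abstract here because the properties of [phi] rest on membership in H^1,
    proved further on. *)
Lemma nodal_basis_eq0 S T j : T \in tris Th -> S \subset T ->
  #|S| = 2%N \/ #|S| = 3%N -> is_node Th j -> ~~ node_in S j ->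
  forall x, hull S x -> ph j x = 0.
Proof.
move=> TT ST Sc nj jS; apply: unisolvent => //.
  exact: sub_Pol (sub_hull ST) (phPol nj TT).
move=> i iS; rewrite ph_node//; last exact: (node_in_is_node TT ST iS).
by case: eqP => // ij; rewrite -ij iS in jS.
Qed.

Lemma nodal_interpolation S T f : T \in tris Th -> S \subset T ->
  #|S| = 2%N \/ #|S| = 3%N -> Pol k.+2 (hull S) f ->
  forall x, hull S x ->
    f x = \sum_(j | node_in S j) f (node_pt Th j) * ph j x.
Proof.
move=> TT ST Sc Pf x Sx; apply/eqP; rewrite -subr_eq0; apply/eqP.
pose g x := f x - \sum_(j | node_in S j) f (node_pt Th j) * ph j x.
apply: (@unisolvent _ _ _ Th k S g) => //.
  apply: PolD => //; apply: PolN; apply: Pol_sum => j jS; apply: PolZ.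
  apply: sub_Pol (sub_hull ST) (phPol _ TT).
  exact: (node_in_is_node TT ST jS).
move=> i iS; rewrite /g (bigD1 i)//= ph_node ?eqxx; last 2 first.
- exact: (node_in_is_node TT ST iS).
- exact: (node_in_is_node TT ST iS).
rewrite mulr1 big1 ?addr0 ?subrr// => j /andP[jS ji].
rewrite ph_node; last 2 first.
- exact: (node_in_is_node TT ST iS).
- exact: (node_in_is_node TT ST jS).
by rewrite eq_sym (negbTE ji) mulr0.
Qed.

End LagrangeBasis.

(** * Lebesgue measure of the plane: open sets, translations, lines *)

Section Plane.
Context {R : realType}.
Implicit Types (A B : set (R * R)) (f : R * R -> R).

HB.instance Definition _ :=
  Measure.copy (@leb2 R) ((@lebesgue_measure R) \x (@lebesgue_measure R))%E.

(** Second countability: an open set is the union of the countably many squares with rational centre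
    and radius that it contains, and squares are measurable rectangles. *)
Lemma open_measurable2 A : open A -> measurable A.
Proof.
move=> oA.
pose box (q : rat * rat * rat) : set (R * R) :=
  ball (ratr q.1.1 : R) (ratr q.2) `*` ball (ratr q.1.2 : R) (ratr q.2).
pose F q := if `[< box q `<=` A >] then box q else set0.
have -> : A = \bigcup_q F q.
  apply/seteqP; split=> [[x y] Axy|x [q _]]; last first.
    by rewrite /F; case: asboolP => // bA; exact: bA.
  have [e e0 eA] : exists2 e : R, 0 < e & ball (x, y) e `<=` A.
    by have /nbhs_ballP[e e0 eA] := open_nbhs_nbhs (conj oA Axy); exists e.
  (* With a centre less than r away from (x, y), all points of the square are within 2 r < e of it;
     the bound e / 4 only keeps r positive. *)
  have /rat_in_itvoo[r] : e / 4 < e / 2 by lra.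
  rewrite in_itv /= => /andP[r1 r2].
  have r0 : 0 < ratr r :> R by lra.
  have /rat_in_itvoo[p] : x - ratr r < x + ratr r by lra.
  rewrite in_itv /= => /andP[p1 p2].
  have /rat_in_itvoo[q] : y - ratr r < y + ratr r by lra.
  rewrite in_itv /= => /andP[q1 q2].
  exists ((p, q), r) => //; rewrite /F; case: asboolP => [_|]; last first.
    case=> -[u v] []; rewrite /ball /= !ltr_norml => /andP[u1 u2] /andP[v1 v2].
    by apply: eA; split; rewrite /ball /= ltr_norml; apply/andP; split; lra.
  by split; rewrite /= /ball /= ltr_norml; apply/andP; split; lra.
apply: countable_bigcupT_measurable => // q; rewrite /F; case: asboolP => // _.
by apply: measurableX; exact: measurable_ball.
Qed.

Lemma continuous_measurable2 f : continuous f -> measurable_fun setT f.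
Proof.
move=> /continuousP cf; apply: (measurability _ (RGenOpens.measurableE R)).
move=> _ [_ [a [b ->] <-]]; rewrite setTI; apply: open_measurable2.
exact/cf/interval_open.
Qed.

Local Notation R2 := (measurableTypeR R * measurableTypeR R)%type.

Definition shift2 (h x : R * R) : R * R := x + h.

Lemma measurable_shift2 h :
  measurable_fun (setT : set R2) (shift2 h : _ -> R2).
Proof.
apply/measurable_fun_pairP; split.
  have : measurable_fun setT (fun x : R * R => x.1 + h.1) by exact: measurable_funD.
  exact.
have : measurable_fun setT (fun x : R * R => x.2 + h.2) by exact: measurable_funD.
exact.
Qed.

Definition shift1 (h x : R) : R := x + h.

Lemma measurable_shift1 h : measurable_fun setT (shift1 h).
Proof. exact: measurable_funD. Qed.

Lemma lebesgue_measure_shift (h : R) (A : set R) : measurable A ->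
  pushforward lebesgue_measure (shift1 h : _ -> measurableTypeR R) A =
  lebesgue_measure A.
Proof.
move=> mA; apply/esym/lebesgue_measure_unique => //=.
  exact: measurable_shift1.
move=> _ _ [[a b]] _ <-; rewrite /pushforward /=.
have -> : shift1 h @^-1` `]a, b] = `]a - h, b - h]%classic.
  by apply/seteqP; split=> x /=; rewrite /shift1 !in_itv /= ltrBlDr lerBrDr.
rewrite !lebesgue_measure_itv /= !lte_fin ltrD2r; case: ifP => // _.
by rewrite -!EFinD; congr EFin; ring.
Qed.

Lemma leb2_shift h (A : set R2) : measurable A ->
  pushforward leb2 (shift2 h : _ -> R2) A = leb2 A.
Proof.
move=> mA; apply/esym/product_measure_unique => //=.
  exact: measurable_shift2.
move=> _ B C mB mC.
rewrite /pushforward.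
have -> : shift2 h @^-1` (B `*` C) =
    (shift1 h.1 @^-1` B) `*` (shift1 h.2 @^-1` C) by [].
rewrite [LHS]product_measure1E; last 2 first.
- by rewrite -[X in measurable X]setTI; exact: measurable_shift1.
- by rewrite -[X in measurable X]setTI; exact: measurable_shift1.
by congr (_ * _)%E; exact: lebesgue_measure_shift.
Qed.

Lemma integral_shift2 h (f : R2 -> \bar R) : measurable_fun setT f ->
  leb2.-integrable setT (f \o shift2 h) ->
  (\int[leb2]_x f (shift2 h x) = \int[leb2]_x f x)%E.
Proof.
move=> mf If.
have := @integral_pushforward _ _ R2 R2 R (shift2 h) (measurable_shift2 h)
  leb2 setT f mf If measurableT.
move=> IP; rewrite -[LHS]IP.
apply: eq_measure_integral => [|? A mA _]; first exact: measurable_shift2.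
exact: leb2_shift.
Qed.

Lemma affine_fun_continuous f : affine_fun f -> continuous f.
Proof.
move=> [a [b [c fE]]] x.
have -> : f = (fun x => a + b * x.1 + c * x.2) by apply/funext.
apply: cvgD; first apply: cvgD; first exact: cvg_cst.
  by apply: cvgM; [exact: cvg_cst|exact: cvg_fst].
by apply: cvgM; [exact: cvg_cst|exact: cvg_snd].
Qed.

Lemma affine_fun_measurable f : affine_fun f -> measurable_fun setT f.
Proof. by move=> /affine_fun_continuous/continuous_measurable2. Qed.

(** The zero set is at most a line. If c is nonzero, each vertical section is a single point and
    Fubini applies; otherwise the line is vertical, the product of a point with the real line. *)
Lemma affine_fun_null f u v : affine_fun f -> f u != f v ->
  leb2.-negligible [set x | f x = 0].
Proof.
move=> af uv; have mf := affine_fun_measurable af.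
have mL : measurable [set x | f x = 0].
  by rewrite -[X in measurable X]setTI; apply: (mf measurableT [set 0]).
apply/negligibleP => //; set L := [set x | f x = 0]; case: af => a [b [c fE]].
have [c0|c0] := eqVneq c 0; last first.
  transitivity (\int[lebesgue_measure]_x
    (lebesgue_measure (xsection L x)))%E; first by [].
  apply: integral0_eq => x _ /=.
  rewrite (_ : xsection _ _ = [set (- a - b * x) / c]) ?lebesgue_measure_set1//.
  apply/seteqP; split=> y; rewrite /xsection /= in_setE /L /= fE /=.
    by move=> e; apply: (mulIf c0); rewrite divfK//; lra.
  by move=> ->; rewrite mulrCA divff// mulr1; ring.
have [b0|b0] := eqVneq b 0.
  by move: uv; rewrite !fE c0 b0 !mul0r eqxx.
have -> : L = [set - a / b] `*` setT.
  apply/seteqP; split=> -[x y] /=; rewrite /L /= fE c0 mul0r addr0 /=.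
    by move=> e; split=> //; apply: (mulIf b0); rewrite divfK//; lra.
  by case=> -> _; rewrite mulrCA divff// mulr1; ring.
by rewrite [LHS]product_measure1E// [X in (X * _)%E]lebesgue_measure_set1 mul0e.
Qed.

End Plane.

(** * Lipschitz bounds along lines and the integral of a directional derivative *)

Section DirectionalLimit.
Context {R : realType}.
Local Notation R2 := (measurableTypeR R * measurableTypeR R)%type.

Lemma bound_bounded (T : Type) (A : set T) (f : T -> R) (C : R) :
  (forall x, A x -> `|f x| <= C) -> [bounded f x | x in A].
Proof.
move=> fC; exists C; split; first exact: num_real.
by move=> M CM x Ax /=; exact: le_trans (fC _ Ax) (ltW CM).
Qed.

Lemma bound_integrable d (T : measurableType d) (mu : {measure set T -> \bar R})
    (D : set T) (f : T -> R) (C : R) :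
  measurable D -> (mu D < +oo)%E -> measurable_fun D f ->
  (forall x, D x -> `|f x| <= C) -> mu.-integrable D (EFin \o f).
Proof.
by move=> mD Doo mf fC; apply: measurable_bounded_integrable => //; exact: bound_bounded fC.
Qed.

(** The closed ball of the sup norm, written as a product so that finite measure and compactness
    come from its factors. *)
Definition box (M : R) : set R2 := `[- M, M]%classic `*` `[- M, M]%classic.

Lemma measurable_box M : measurable (box M).
Proof. by apply: measurableX; exact: measurable_itv. Qed.

Lemma box_finite M : (leb2 (box M) < +oo)%E.
Proof.
rewrite [X in (X < _)%E]product_measure1E//.
have lI : @Order.lt _ _ (lebesgue_measure (`[- M, M]%classic : set R)) +oo%E.
  by rewrite lebesgue_measure_itv /=; case: ifP => // _; rewrite -EFinB ltry.
by apply: lte_mul_pinfty => //; rewrite ge0_fin_numE.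
Qed.

Lemma box_norm M (x : R * R) : box M x <-> `|x| <= M.
Proof.
rewrite /box /= !in_itv /= prod_normE ge_max -!ler_norml.
by split=> /andP.
Qed.

Lemma bounded_set_box (A : set (R * R)) : bounded_set A -> exists M, A `<=` box M.
Proof.
move=> [M [_ AM]]; exists (M + 1) => x Ax; apply/box_norm.
by apply: (AM _ _ x Ax); rewrite ltrDl.
Qed.

Lemma compact_box M : compact (box M : set (R * R)).
Proof. by apply: compact_setX; exact: segment_compact. Qed.

Lemma continuous_bounded_on (f : R * R -> R) (A : set (R * R)) : continuous f ->
  bounded_set A -> exists2 C, 0 <= C & forall x, A x -> `|f x| <= C.
Proof.
move=> cf /bounded_set_box[M AM].
have : compact (f @` (box M : set (R * R))).
  apply: continuous_compact; last exact: compact_box.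
  exact: continuous_subspaceT.
move=> /compact_bounded[N [_ HN]]; exists (`|N| + 1); first by rewrite addr_ge0.
move=> x /AM bx; apply: (HN (`|N| + 1)); last by exists x.
by rewrite (le_lt_trans (ler_norm _))// ltrDl.
Qed.

(* A function which is Lipschitz on each of finitely many closed sets covering
   the line is Lipschitz. *)
Lemma closed_cover_lipschitz (I : finType) (C : I -> set R) (g : R -> R) (L : R) :
  0 <= L -> (forall i, closed (C i)) -> (forall t, exists i, C i t) ->
  (forall i s t, C i s -> C i t -> `|g s - g t| <= L * `|s - t|) ->
  forall s t, `|g s - g t| <= L * `|s - t|.
Proof.
move=> L0 cC covC lC.
(* The closed sets that miss t also miss a neighbourhood of t. Hence any closed set containing a
   nearby s contains t as well, and its Lipschitz bound applies to the pair. *)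
have near_lip t : \forall s \near t, `|g s - g t| <= L * `|s - t|.
  have : \forall s \near t, forall i, C i s -> C i t.
    apply: (@filter_forall R I (fun i s => C i s -> C i t) (nbhs t) _) => i.
    have [Cit|nCit] := pselect (C i t).
      by apply: nearW.
    have : nbhs t (~` C i) by apply: open_nbhs_nbhs; split => //; exact: closed_openC.
    by apply: filterS => s.
  by apply: filterS => s Hs; have [i Cis] := covC s; apply: (lC i) => //; exact: Hs.
suff mono a b : a <= b -> `|g b - g a| <= L * (b - a).
  move=> s t; have [st|ts] := leP s t.
    by rewrite distrC [X in L * X]distrC (ger0_norm (x := t - s)) ?subr_ge0// mono.
  by rewrite (ger0_norm (x := s - t)) ?subr_ge0 ?mono// ltW.
(* Continuous induction: [near_lip] at c = sup A first puts c into A and then, if c < b, pushes A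
   beyond c, a contradiction. *)
move=> ab; pose A := [set t | a <= t <= b /\ `|g t - g a| <= L * (t - a)].
have Aa : A a by split; rewrite ?lexx ?ab// !subrr normr0 mulr0.
have hsA : has_sup A by split; [exists a|exists b => t [/andP[]]].
set c := sup A.
have ac : a <= c by apply: (ub_le_sup hsA.2).
have cb : c <= b by apply: ge_sup => //; [exists a|move=> t [/andP[]]].
have [d /= d0 Hd] : exists2 d : R, 0 < d & forall s, `|s - c| < d ->
    `|g s - g c| <= L * `|s - c|.
  have /nbhs_ballP[d d0 Hd] := near_lip c; exists d => // s sc.
  by apply: Hd; rewrite /ball /= distrC.
have Ac : A c.
  have [t At ct] : exists2 t, A t & c - d < t by apply: sup_adherent.
  have tc : t <= c by apply: (ub_le_sup hsA.2).
  split; first by rewrite ac cb.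
  have -> : g c - g a = - (g t - g c) + (g t - g a) by ring.
  rewrite (le_trans (ler_normD _ _))// normrN.
  have -> : L * (c - a) = L * (c - t) + L * (t - a) by ring.
  apply: lerD; last by case: At.
  have := Hd t; rewrite distrC ger0_norm ?subr_ge0//; apply; lra.
have [->|cnb] := eqVneq b c; first by case: Ac.
have cltb : c < b by rewrite lt_neqAle eq_sym cnb cb.
pose e := Num.min (d / 2) (b - c).
have e0 : 0 < e by rewrite lt_min divr_gt0//= subr_gt0.
have ed : e < d by rewrite gt_min; apply/orP; left; lra.
have eb : e <= b - c by rewrite ge_min lexx orbT.
suff : A (c + e) by move=> /(ub_le_sup hsA.2); rewrite leNgt ltrDl e0.
split; first by apply/andP; split; lra.
have -> : g (c + e) - g a = (g (c + e) - g c) + (g c - g a) by ring.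
rewrite (le_trans (ler_normD _ _))//.
have -> : L * (c + e - a) = L * e + L * (c - a) by ring.
apply: lerD; last by case: Ac.
have := Hd (c + e); rewrite addrC addKr (ger0_norm (ltW e0)); exact.
Qed.

End DirectionalLimit.

Section IntegralDirectionalDerivative.
Context {R : realType}.
Local Notation R2 := (measurableTypeR R * measurableTypeR R)%type.
Variables (e : R * R) (W DW : R2 -> R) (M C L : R).
Hypotheses (mW : measurable_fun setT W) (mDW : measurable_fun setT DW).
Hypotheses (W_bound : forall x, `|W x| <= C)
  (W_supp : forall x, ~ box M x -> W x = 0)
  (W_lip : forall x h, `|W (x + h *: e) - W x| <= L * `|h|).

Let quotient (n : nat) (x : R2) : R := n.+1%:R * (W (x + n.+1%:R^-1 *: e) - W x).

Hypothesis quotient_cvg : {ae leb2, forall x, quotient n x @[n --> \oo] --> DW x}.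

Lemma supp_integrable (N D : R) (f : R2 -> R) : measurable_fun setT f ->
  (forall x, `|f x| <= D) -> (forall x, ~ box N x -> f x = 0) ->
  leb2.-integrable setT (EFin \o f).
Proof.
move=> mf fD fN.
have -> : EFin \o f = (EFin \o f) \_ (box N).
  apply/funext => x; rewrite patchE; case: ifPn => //= /negP xM.
  by rewrite fN// => bx; apply: xM; rewrite inE.
apply/integrable_restrict => //; first exact: measurable_box.
rewrite setTI; apply: (bound_integrable (C := D)) => //.
- exact: measurable_box.
- exact: box_finite.
- exact: measurable_funTS.
Qed.

Let shift_supp (h : R * R) (x : R2) : `|h| <= `|e| -> ~ box (M + `|e|) x ->
  W (x + h) = 0 /\ W x = 0.
Proof.
move=> he xM; split; apply: W_supp => /box_norm xM'; apply: xM; apply/box_norm.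
  have -> : x = (x + h) - h :> R * R by rewrite addrK.
  by rewrite (le_trans (ler_normB _ _))// lerD.
by rewrite (le_trans xM')// lerDl.
Qed.

Let step_norm n : `|n.+1%:R^-1 *: e| <= `|e|.
Proof.
rewrite normrZ ger0_norm ?invr_ge0// ler_piMl// invf_le1 ?ltr0Sn//.
by rewrite ler1n.
Qed.

Lemma integral_directional_derivative :
  leb2.-integrable setT (EFin \o DW) /\ \int[leb2]_x DW x = 0.
Proof.
have mWs h : measurable_fun setT (fun x : R2 => W (x + h)).
  exact: (measurableT_comp mW (measurable_shift2 h)).
have mq n : measurable_fun setT (quotient n).
  by apply: measurable_funM => //; apply: measurable_funB.
have iW : leb2.-integrable setT (EFin \o W) by exact: supp_integrable W_supp.
have iWs n : leb2.-integrable setT (EFin \o (fun x : R2 => W (x + n.+1%:R^-1 *: e))).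
  apply: (@supp_integrable (M + `|e|) C) => // x.
  by move=> /(shift_supp (step_norm n))[].
have iq n : leb2.-integrable setT
    (EFin \o (fun x : R2 => W (x + n.+1%:R^-1 *: e) - W x)).
  have := integrableB measurableT (iWs n) iW.
  by apply: eq_integrable.
have q0 n : (\int[leb2]_x (quotient n x)%:E = 0)%E.
  have : \int[leb2]_x quotient n x = 0.
    rewrite /quotient RintegralZl// RintegralB//.
    have mWE : measurable_fun setT (EFin \o W) by exact/measurable_EFinP.
    have H := @integral_shift2 R (n.+1%:R^-1 *: e) (EFin \o W) mWE (iWs n).
    by rewrite [X in X - _](congr1 fine H) subrr mulr0.
  have : leb2.-integrable setT (EFin \o quotient n).
    have := integrableZl measurableT n.+1%:R (iq n).
    by apply: eq_integrable.
  by move=> /(integrable_fin_num measurableT) /fineK <- H; congr EFin.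
(* One majorant for all n: the steps have norm at most [|e|], so every quotient vanishes off the
   enlarged box, and inside it the Lipschitz condition bounds it by L. *)
pose g0 : R2 -> R := (fun=> L) \_ (box (M + `|e|)).
have L0 : 0 <= L.
  by have := le_trans (normr_ge0 _) (W_lip (0, 0) 1); rewrite normr1 mulr1.
have gi : leb2.-integrable setT (EFin \o g0).
  apply: (@supp_integrable (M + `|e|) L).
  - apply/measurable_restrict => //; first exact: measurable_box.
  - by move=> x; rewrite /g0 patchE; case: ifP; rewrite ?normr0// ger0_norm.
  - by move=> x nx; rewrite /g0 patchE; case: ifPn => //; rewrite inE.
have qg n x : `|quotient n x| <= g0 x.
  rewrite /g0 patchE; case: ifPn => [_|].
    rewrite /quotient normrM (ger0_norm (ler0n _ _)).
    rewrite (le_trans (ler_wpM2l _ (W_lip _ _)))// ger0_norm ?invr_ge0//.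
    by rewrite mulrCA divff// mulr1.
  rewrite notin_setE => /(shift_supp (step_norm n))[H1 H2].
  by rewrite /quotient H1 H2 subrr mulr0 normr0.
have [] := @dominated_convergence _ R2 R leb2 setT measurableT
  (fun n => EFin \o quotient n) (EFin \o DW) (EFin \o g0).
- by move=> n; exact/measurable_EFinP.
- exact/measurable_EFinP.
- apply: filterS quotient_cvg => x qx _.
  by apply: cvg_EFin qx; exact: nearW.
- exact: gi.
- by apply: aeW => x n _; rewrite /= lee_fin.
move=> iDW _ cv; split => //.
have D0 : (\int[leb2]_x (EFin \o DW) x = 0)%E.
  apply: (@cvg_unique _ (@ereal_hausdorff R) _ _ _ _ cv).
  by rewrite (_ : [sequence _]_n = fun=> 0%E); [exact: cvg_cst|exact/funext].
by rewrite /Rintegral (_ : integral _ _ _ = 0%E).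
Qed.

End IntegralDirectionalDerivative.

(** * Continuously differentiable extensions of polynomials *)

Section PolynomialRegularity.
Context {R : realType}.
Implicit Types (f g : R * R -> R) (x e : R * R).

Lemma Cn1P f : Cn 1 f <-> continuous f /\
  forall e, (forall x, derivable f x e) /\ continuous ('D_e f).
Proof. by []. Qed.

Lemma is_derive_linear f e x : (forall (h : R) u v, f (h *: u + v) = h * f u + f v) ->
  is_derive x e f (f e).
Proof.
move=> lf; have H : h^-1 *: ((f \o shift x) (h *: e) - f x) @[h --> 0^'] --> f e.
  apply: cvg_near_cst; near=> h.
  have h0 : h != 0 by near: h; exact: nbhs_dnbhs_neq.
  by rewrite /= lf addrK /GRing.scale /= mulKf.
apply: DeriveDef; first by apply/cvg_ex; exists (f e).
exact: cvg_lim H.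
Unshelve. all: by end_near. Qed.

Lemma Cn1_cst (c : R) : Cn 1 (fun=> c : R).
Proof.
apply/Cn1P; split=> [x|e]; first exact: cvg_cst.
split=> [x|]; first exact: derivable_cst.
rewrite (_ : 'D_e _ = fun=> 0); first by move=> x; exact: cvg_cst.
by apply/funext => x; rewrite derive_cst.
Qed.

Lemma Cn1_fst : Cn 1 (fst : R * R -> R).
Proof.
have H x e : is_derive x e (fst : R * R -> R) e.1 by exact: is_derive_linear.
apply/Cn1P; split=> [x|e]; first exact: cvg_fst.
split=> [x|]; first by have [] := H x e.
rewrite (_ : 'D_e _ = fun=> e.1); first by move=> x; exact: cvg_cst.
by apply/funext => x; have [] := H x e.
Qed.

Lemma Cn1_snd : Cn 1 (snd : R * R -> R).
Proof.
have H x e : is_derive x e (snd : R * R -> R) e.2 by exact: is_derive_linear.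
apply/Cn1P; split=> [x|e]; first exact: cvg_snd.
split=> [x|]; first by have [] := H x e.
rewrite (_ : 'D_e _ = fun=> e.2); first by move=> x; exact: cvg_cst.
by apply/funext => x; have [] := H x e.
Qed.

Lemma Cn1D f g : Cn 1 f -> Cn 1 g -> Cn 1 (fun x => f x + g x).
Proof.
move=> /Cn1P[cf df] /Cn1P[cg dg]; apply/Cn1P.
split=> [x|e]; first by apply: cvgD; [exact: cf|exact: cg].
have [{}df cdf] := df e; have [{}dg cdg] := dg e.
split=> [x|]; first exact: derivableD.
rewrite (_ : 'D_e _ = fun x => 'D_e f x + 'D_e g x).
  by move=> x; apply: cvgD; [exact: cdf|exact: cdg].
by apply/funext => x; rewrite -deriveD.
Qed.

Lemma Cn1M f g : Cn 1 f -> Cn 1 g -> Cn 1 (fun x => f x * g x).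
Proof.
move=> /Cn1P[cf df] /Cn1P[cg dg]; apply/Cn1P.
split=> [x|e]; first by apply: cvgM; [exact: cf|exact: cg].
have [{}df cdf] := df e; have [{}dg cdg] := dg e.
split=> [x|]; first exact: derivableM.
rewrite (_ : 'D_e _ = fun x => f x * 'D_e g x + g x * 'D_e f x).
  move=> x; apply: cvgD; apply: cvgM; [exact: cf|exact: cdg|exact: cg|exact: cdf].
by apply/funext => x; rewrite -[RHS]deriveM.
Qed.

Lemma Cn1X f n : Cn 1 f -> Cn 1 (fun x => f x ^+ n).
Proof.
move=> Cf; elim: n => [|n IH]; first exact: Cn1_cst.
rewrite (_ : (fun _ => _) = (fun x => f x * f x ^+ n)); first exact: Cn1M.
by apply/funext => x; rewrite exprS.
Qed.

Lemma Cn1_sum (I : Type) (r : seq I) (P : pred I) (F : I -> R * R -> R) :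
  (forall i, Cn 1 (F i)) -> Cn 1 (fun x => \sum_(i <- r | P i) F i x).
Proof.
move=> CF; elim: r => [|a r IH].
  rewrite (_ : (fun _ => _) = (fun=> 0)); first exact: Cn1_cst.
  by apply/funext => x; rewrite big_nil.
case Pa : (P a); last first.
  by under [X in Cn 1 X]funext => x do rewrite big_cons Pa.
under [X in Cn 1 X]funext => x do rewrite big_cons Pa.
exact: Cn1D.
Qed.

(** Gives a function differentiable on the whole plane in place of one known on a closed triangle,
    so that no derivative is taken at the boundary of a domain. *)
Lemma Pol_extension (r : int) (D : set (R * R)) f : Pol r D f ->
  exists g, [/\ Pol r setT g, Cn 1 g & forall x, D x -> f x = g x].
Proof.
case=> c cf; pose g (x : R * R) := \sum_(i < `|r|.+1)
  \sum_(j < `|r|.+1 | (i + j)%N%:Z <= r) c i j * x.1 ^+ i * x.2 ^+ j.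
exists g; split=> //; first by exists c.
apply: Cn1_sum => i; apply: Cn1_sum => j; apply: Cn1M; last exact: Cn1X Cn1_snd.
by apply: Cn1M; [exact: Cn1_cst|exact: Cn1X Cn1_fst].
Qed.

Lemma derive_quotient_cvg f x e : derivable f x e ->
  n.+1%:R * (f (x + n.+1%:R^-1 *: e) - f x) @[n --> \oo] --> 'D_e f x.
Proof.
move=> df; have h0 : (fun n => n.+1%:R^-1 : R) @ \oo --> (0 : R)^'.
  move=> A /= A0; have := @cvg_harmonic R _ A0; rewrite /nbhs /=.
  by apply: filterS => n /=; apply; rewrite /harmonic /= invr_eq0.
have := cvg_comp _ _ h0 df; apply: cvg_trans; apply: near_eq_cvg.
by apply: nearW => n; rewrite /= invrK [_ + x]addrC.
Qed.

Lemma directional_lipschitz f e (L : R) : (forall x, derivable f x e) ->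
  (forall x, `|'D_e f x| <= L) ->
  forall x h, `|f (x + h *: e) - f x| <= L * `|h|.
Proof.
move=> df DL x h; pose g t := f (x + t *: e).
have dg (t : R) : is_derive t (1 : R) g ('D_e f (x + t *: e)).
  have E : (fun h => h^-1 *: ((g \o shift t) (h *: 1) - g t)) =
      (fun h => h^-1 *: ((f \o shift (x + t *: e)) (h *: e) - f (x + t *: e))).
    apply/funext => u; congr (_ *: (f _ - _)).
    by rewrite /= [u *: _]mulr1 scalerDl addrCA.
  by apply: DeriveDef; rewrite /derivable /derive E //; exact: df.
suff mono (a b : R) : a <= b -> `|g b - g a| <= L * (b - a).
  have -> : f x = g 0 by rewrite /g scale0r addr0.
  have [h0|h0] := leP 0 h.
    by rewrite (ger0_norm h0) -[X in _ * X](subr0 h) mono.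
  by rewrite distrC (ltr0_norm h0) -[X in _ * X](sub0r h) mono// ltW.
move=> ab; have cg : {within `[a, b], continuous g}.
  by apply: derivable_within_continuous => t _; have [] := dg t.
have [c _ ->] := MVT_segment ab (fun t _ => dg t) cg.
by rewrite normrM (ger0_norm (x := b - a)) ?subr_ge0// ler_wpM2r ?subr_ge0.
Qed.

Lemma derive_eq0_off (K : set (R * R)) f : closed K -> (forall x, ~ K x -> f x = 0) ->
  forall x e, ~ K x -> 'D_e f x = 0.
Proof.
move=> cK f0 x e nKx; rewrite -[RHS](derive_cst (0 : R) x e); apply: near_eq_derive.
have : nbhs x (~` K) by apply: open_nbhs_nbhs; split => //; exact: closed_openC.
by apply: filterS => y /f0.
Qed.

End PolynomialRegularity.

(** * Functions that are smooth on each triangle and agree across edges belong to H^1 *)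

Section PiecewisePolynomialH1.
Context {R : realType} {V : finType} {Omega : set (R * R)}.
Variable Th : triangulation V Omega.
Local Notation hull := (hull (pos Th)).
Local Notation R2 := (measurableTypeR R * measurableTypeR R)%type.
Implicit Types (T : {set V}) (x e : R * R).

Lemma measurable_fun_cover d d' (X : measurableType d) (Y : measurableType d')
    (I : finType) (A : I -> set X) (D : set X) (g : X -> Y) :
  (forall i, measurable (A i)) -> (forall i, measurable_fun (A i) g) ->
  D `<=` \bigcup_i A i -> measurable_fun D g.
Proof.
move=> mA mg DA mD B mB.
have -> : D `&` g @^-1` B = \bigcup_(i in [set: I]) (D `&` (A i `&` g @^-1` B)).
  apply/seteqP; split=> [x [Dx Bx]|x [i _ [Dx [_ Bx]]]]; last by split.
  by have [i _ Aix] := DA _ Dx; exists i.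
apply: fin_bigcup_measurable; first exact: finite_finset.
by move=> i _; apply: measurableI => //; apply: mg.
Qed.

Variable beta : {set V} -> V -> R * R -> R.
Hypothesis betaP : forall T, T \in tris Th -> barycentric (pos Th) T (beta T).

Lemma closed_hull T : T \in tris Th -> closed (hull T).
Proof.
move=> TT; have -> : hull T =
    \bigcap_(l in [set: V]) (beta T l @^-1` [set t | 0 <= t]).
  apply/seteqP; split=> x.
    by move/(hullE (tri_nondegenerate TT) (betaP TT)) => H l _; exact: H.
  by move=> H; apply/(hullE (tri_nondegenerate TT) (betaP TT)) => l; exact: H.
apply: closed_bigI => l _; apply: closed_comp; last exact: closed_ge.
have [/(_ l) al _ _ _] := betaP TT.
by move=> x _; exact: affine_fun_continuous.
Qed.

Lemma measurable_closed2 (A : set (R * R)) : closed A -> measurable A.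
Proof. by move=> /closed_openC/open_measurable2/measurableC; rewrite setCK. Qed.

(** Near each of its points f coincides with the single function [P T]; by [ae_off_edges] almost
    every point of the hull belongs to it. *)
Definition open_tri T := [set x | forall l, l \in T -> 0 < beta T l x].

Lemma open_open_tri T : T \in tris Th -> open (open_tri T).
Proof.
move=> TT; rewrite openE => x Tx; rewrite /interior /=.
apply: (@filter_forall _ V (fun l y => l \in T -> 0 < beta T l y) (nbhs x) _) => l.
have [lT|lT] := boolP (l \in T); last by apply: nearW.
have [/(_ l) al _ _ _] := betaP TT.
have o : nbhs (beta T l x) [set t | 0 < t].
  by apply: open_nbhs_nbhs; split; [exact: open_gt|exact: Tx].
have H := affine_fun_continuous al o.
by move: H; apply: (@filterS _ (nbhs x)) => y /= ? _.
Qed.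

Lemma open_tri_hull T : T \in tris Th -> open_tri T `<=` hull T.
Proof.
move=> TT x Tx; apply/(hullE (tri_nondegenerate TT) (betaP TT)) => l.
have [lT|lT] := boolP (l \in T); first exact/ltW/Tx.
by have [_ -> //] := betaP TT.
Qed.

(** The coordinate at l is 1 at the vertex l and 0 at another vertex of T, hence a nonconstant
    affine function, whose zero set is null. *)
Lemma ae_off_edges : {ae leb2, forall x : R2, forall T l, T \in tris Th ->
  l \in T -> beta T l x != 0}.
Proof.
apply: (@filter_forall R2 _ (fun T x => forall l, T \in tris Th ->
  l \in T -> beta T l x != 0) (almost_everywhere leb2) _) => T.
apply: (@filter_forall R2 _ (fun l x => T \in tris Th ->
  l \in T -> beta T l x != 0) (almost_everywhere leb2) _) => l.
have [TT|TT] := boolP (T \in tris Th); last by apply: aeW.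
have [lT|lT] := boolP (l \in T); last by apply: aeW.
have [m mT lm] : exists2 m, m \in T & l != m.
  have : (1 < #|T|)%N by rewrite (card_tri TT).
  rewrite (cardsD1 l) lT add1n ltnS card_gt0 => /set0Pn[m].
  by rewrite !inE => /andP[ml mT]; exists m => //; rewrite eq_sym.
have bv := barycentric_vertex (tri_nondegenerate TT) (betaP TT).
have [/(_ l) al _ _ _] := betaP TT.
have : leb2.-negligible [set x | beta T l x = 0].
  apply: (affine_fun_null (u := pos Th l) (v := pos Th m) al).
  by rewrite !bv// eqxx (negbTE lm) oner_neq0.
apply: negligibleS => x /= nb; apply: contrapT => b0.
by apply: nb => _ _; apply/eqP.
Qed.

Hypothesis hOmega : polygonal_domain Omega.
Variables (f : R * R -> R) (P : {set V} -> R * R -> R).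
Hypotheses (PC : forall T, Cn 1 (P T))
  (fP : forall T x, T \in tris Th -> hull T x -> f x = P T x).

Let oO : open Omega. Proof. by case: hOmega. Qed.
Let bO : bounded_set Omega. Proof. by case: hOmega. Qed.

(** A closed cover of the plane adapted to f times a test function: on a triangle the product is
    smooth, and on the complement of Omega it is zero. *)
Let cover (i : option {set V}) : set R2 :=
  if i is Some T then (if T \in tris Th then hull T else set0) else ~` Omega.

Let closure_hull x : closure Omega x -> exists2 T, T \in tris Th & hull T x.
Proof. by rewrite (tri_cover Th) => -[T TT Tx]; exists T. Qed.

Let cover_closed i : closed (cover i : set (R * R)).
Proof.
case: i => [T|] /=; last exact: open_closedC.
case: ifP => TT; [exact: closed_hull|exact: closed0].
Qed.

Let cover_measurable i : measurable (cover i).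
Proof. exact: measurable_closed2. Qed.

Let coverT x : exists i, cover i x.
Proof.
have [Ox|nOx] := pselect (Omega x); last by exists None.
have [T TT Tx] := closure_hull (subset_closure Ox).
by exists (Some T); rewrite /cover TT.
Qed.

Let cont_P T : continuous (P T). Proof. by case: (PC T). Qed.

Let measurable_cts (D : set R2) (g : R * R -> R) : continuous g ->
  measurable_fun D (g : R2 -> R).
Proof.
move=> cg; apply: (@measurable_funS _ _ R2 _ setT) => //.
exact: continuous_measurable2.
Qed.

(** Outside the closure of Omega f is arbitrary, so on the whole plane measurability is claimed only
    after multiplication by a function that vanishes off Omega. *)
Lemma measurable_piecewise_mul (psi : R * R -> R) : continuous psi ->
  (forall x, ~ Omega x -> psi x = 0) ->
  measurable_fun setT (fun x : R2 => f x * psi x).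
Proof.
move=> cpsi psi0.
apply: (@measurable_fun_cover _ _ R2 _ _ cover) => //; last first.
  by move=> x _; have [i ix] := coverT x; exists i.
move=> [T|]; rewrite /=.
  case: ifP => TT; last first.
    by move=> m B mB; rewrite set0I.
  apply: (eq_measurable_fun (fun x => P T x * psi x)).
    by move=> x; rewrite inE => /(fP TT) ->.
  by apply: measurable_funM; apply: measurable_cts.
apply: (eq_measurable_fun (fun _ : R2 => 0 : R)) => //.
by move=> x; rewrite inE => /psi0 ->; rewrite mulr0.
Qed.

Lemma measurable_piecewise : measurable_fun Omega f.
Proof.
apply: (@measurable_fun_cover _ _ R2 _ _ (fun T => cover (Some T))) => //.
  move=> T; rewrite /=; case: ifP => TT; last by move=> m B mB; rewrite set0I.
  apply: (eq_measurable_fun (P T)); last exact: measurable_cts.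
  by move=> x; rewrite inE => /(fP TT) ->.
move=> x /subset_closure/closure_hull[T TT Tx]; exists T => //=.
by rewrite TT.
Qed.

Let UU : set R2 := \bigcup_(T in [set T | T \in tris Th]) open_tri T.

Let open_tri_near T x : T \in tris Th -> open_tri T x ->
  \forall y \near x, f y = P T y.
Proof.
move=> TT Tx; have : nbhs x (open_tri T).
  by apply: open_nbhs_nbhs; split => //; exact: open_open_tri.
by apply: (@filterS _ (nbhs x)) => y /(open_tri_hull TT)/(fP TT).
Qed.

Let derivable_open_tri T e x : T \in tris Th -> open_tri T x ->
  derivable f x e /\ 'D_e f x = 'D_e (P T) x.
Proof.
move=> TT Tx; have near_f := open_tri_near TT Tx.
have [_ /(_ e)[dP _]] := PC T.
split; last exact: near_eq_derive.
apply: near_eq_derivable (dP x); move: near_f.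
by apply: (@filterS _ (nbhs x)) => y ->.
Qed.

(** Zero is put off the open triangles: on the edges f may have no derivative, and within the
    closure of Omega only a null set is affected. *)
Definition piecewise_derive e : R2 -> R := ('D_e f : R2 -> R) \_ UU.

Let piecewise_deriveE T e x : T \in tris Th -> open_tri T x ->
  piecewise_derive e x = 'D_e (P T) x.
Proof.
move=> TT Tx; have [_ <-] := derivable_open_tri e TT Tx.
by rewrite /piecewise_derive patchE mem_set//; exists T.
Qed.

Lemma measurable_piecewise_derive e : measurable_fun setT (piecewise_derive e).
Proof.
have mU T : T \in tris Th -> measurable (open_tri T : set R2).
  by move=> TT; apply: open_measurable2; exact: open_open_tri.
have mUU : measurable UU.
  by apply: fin_bigcup_measurable; [exact: finite_finset|exact: mU].
pose A (i : option {set V}) : set R2 := if i is Some T then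
  (if T \in tris Th then open_tri T else set0) else ~` UU.
apply: (@measurable_fun_cover _ _ R2 _ _ A).
- move=> [T|]; rewrite /A; last exact: measurableC.
  by case: ifP => // TT; exact: mU.
- move=> [T|]; rewrite /A; last first.
    apply: (eq_measurable_fun (fun _ : R2 => 0 : R)) => // x.
    by rewrite inE => /= nU; rewrite /piecewise_derive patchE memNset.
  case: ifP => TT; last by move=> m B mB; rewrite set0I.
  apply: (eq_measurable_fun ('D_e (P T))).
    by move=> x; rewrite inE => /(piecewise_deriveE e TT) ->.
  by apply: measurable_cts; have [_ /(_ e)[]] := PC T.
- move=> x _; have [[T TT Tx]|nU] := pselect (UU x); last by exists None.
  by exists (Some T) => //; rewrite /A ifT.
Qed.

Lemma piecewise_bounded : exists C, forall x, Omega x -> `|f x| <= C.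
Proof.
have /choice[C HC] : forall T, exists C, 0 <= C /\
    forall x, Omega x -> `|P T x| <= C.
  by move=> T; have [C C0 H] := continuous_bounded_on (@cont_P T) bO; exists C.
exists (\sum_T C T) => x Ox.
have [T TT Tx] := closure_hull (subset_closure Ox).
rewrite (fP TT Tx) (le_trans ((HC T).2 _ Ox))// (bigD1 T)//= lerDl.
by apply: sumr_ge0 => S _; case: (HC S).
Qed.

Lemma piecewise_derive_bounded e :
  exists2 C, 0 <= C & forall x, Omega x -> `|piecewise_derive e x| <= C.
Proof.
have /choice[C HC] : forall T, exists C, 0 <= C /\
    forall x, Omega x -> `|'D_e (P T) x| <= C.
  move=> T; have [_ /(_ e)[_ cD]] := PC T.
  by have [C C0 H] := continuous_bounded_on cD bO; exists C.
exists (\sum_T C T) => [|x Ox]; first by apply: sumr_ge0 => S _; case: (HC S).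
have [[T TT Tx]|nU] := pselect (UU x); last first.
  rewrite /piecewise_derive patchE memNset// normr0.
  by apply: sumr_ge0 => S _; case: (HC S).
rewrite (piecewise_deriveE e TT Tx) (le_trans ((HC T).2 _ Ox))// (bigD1 T)//= lerDl.
by apply: sumr_ge0 => S _; case: (HC S).
Qed.

Lemma compact_supp_bounded (K : set (R * R)) (g : R * R -> R) : compact K ->
  continuous g -> (forall x, ~ K x -> g x = 0) ->
  exists2 C, 0 <= C & forall x, `|g x| <= C.
Proof.
move=> cK cg g0; have [C C0 HC] := continuous_bounded_on cg (compact_bounded cK).
exists C => // x; have [/HC//|/g0 ->] := pselect (K x); by rewrite normr0.
Qed.

Lemma piecewise_weak_derivative e : weak_derivative Omega e f (piecewise_derive e).
Proof.
move=> phi [sm [K [cK KO phi0]]].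
have clK : closed K by apply: compact_closed cK; exact: norm_hausdorff.
have Cphi : Cn 1 phi := sm 1%N.
have [cphi /(_ e)[dphi cpsi]] := Cphi.
set psi := 'D_e phi in cpsi *.
have psi0 x : ~ K x -> psi x = 0 by exact: (derive_eq0_off clK phi0).
have offO x : ~ Omega x -> ~ K x by move=> nO /KO.
have phiO x : ~ Omega x -> phi x = 0 by move=> /offO/phi0.
have psiO x : ~ Omega x -> psi x = 0 by move=> /offO/psi0.
(* Each [F T] is C^1 on the plane with support in K, hence bounded and Lipschitz along e; W
   coincides with it on the hull of T. *)
pose F T x := P T x * phi x.
have CF T : Cn 1 (F T) by exact: Cn1M.
have DF T x : 'D_e (F T) x = P T x * psi x + phi x * 'D_e (P T) x.
  by have [_ /(_ e)[dP _]] := PC T; exact: deriveM.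
have F0 T x : ~ K x -> F T x = 0 by move=> /phi0; rewrite /F => ->; rewrite mulr0.
have /choice[L HL] : forall T, exists L, 0 <= L /\
    forall x h, `|F T (x + h *: e) - F T x| <= L * `|h|.
  move=> T; have [_ /(_ e)[dF cDF]] := CF T.
  have [L L0 HL] := compact_supp_bounded cK cDF (fun x => derive_eq0_off clK (@F0 T) e (x := x)).
  by exists L; split => //; exact: directional_lipschitz.
have /choice[C HC] : forall T, exists C, 0 <= C /\ forall x, `|F T x| <= C.
  move=> T; have [cF _] := CF T.
  by have [C C0 H] := compact_supp_bounded cK cF (@F0 T); exists C.
pose W : R2 -> R := fun x => f x * phi x.
have WF T x : T \in tris Th -> hull T x -> W x = F T x.
  by move=> TT Tx; rewrite /W (fP TT Tx).
have W0 x : ~ Omega x -> W x = 0 by move=> /phiO; rewrite /W => ->; rewrite mulr0.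
pose B : R2 -> R := fun x => piecewise_derive e x * phi x.
pose A : R2 -> R := fun x => f x * psi x.
have mA : measurable_fun setT A by exact: measurable_piecewise_mul.
have mB : measurable_fun setT B.
  by apply: measurable_funM; [exact: measurable_piecewise_derive|exact: measurable_cts].
have [M OM] := bounded_set_box bO.
have [Cf HCf] := piecewise_bounded.
have [Cp Cp0 HCp] := compact_supp_bounded cK cpsi psi0.
have [Cq Cq0 HCq] := compact_supp_bounded cK cphi phi0.
have [Cd Cd0 HCd] := piecewise_derive_bounded e.
have iA : leb2.-integrable setT (EFin \o A).
  apply: (@supp_integrable _ M (`|Cf| * Cp)) => // x.
    have [Ox|nOx] := pselect (Omega x); last by rewrite /A psiO// mulr0 normr0 mulr_ge0.
    by rewrite normrM ler_pM// (le_trans (HCf _ Ox))// ler_norm.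
  by move=> nM; rewrite /A psiO ?mulr0// => /OM.
have iB : leb2.-integrable setT (EFin \o B).
  apply: (@supp_integrable _ M (Cd * Cq)) => // x.
    have [Ox|nOx] := pselect (Omega x); last by rewrite /B phiO// mulr0 normr0 mulr_ge0.
    by rewrite normrM ler_pM// HCd.
  by move=> nM; rewrite /B phiO ?mulr0// => /OM.
(* The product rule for f * phi, so that the vanishing of its integral is the integration by parts
   formula. *)
pose DW : R2 -> R := fun x => B x + A x.
have [] := @integral_directional_derivative R e W DW M (\sum_T C T) (\sum_T L T).
- exact: measurable_piecewise_mul.
- exact: measurable_funD.
- move=> x; have [Ox|nOx] := pselect (Omega x).
    have [T TT Tx] := closure_hull (subset_closure Ox).
    rewrite (WF _ _ TT Tx) (le_trans ((HC T).2 _))// (bigD1 T)//= lerDl.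
    by apply: sumr_ge0 => S _; case: (HC S).
  by rewrite W0// normr0; apply: sumr_ge0 => S _; case: (HC S).
- by move=> x nM; apply: W0 => /OM.
- move=> x h.
  have ct : continuous (fun t : R => x + t *: e).
    move=> t; apply: cvgD; first exact: cvg_cst.
    by apply: cvgZr_tmp; exact: cvg_id.
  (* The cover is pulled back to the line through x in direction e. The sum of all constants [L T]
     serves every piece at once. *)
  have := @closed_cover_lipschitz R _ (fun i => [set t | cover i (x + t *: e)])
    (fun t => W (x + t *: e)) (\sum_T L T).
  move=> /(_ _ _ _ _ h 0); rewrite scale0r addr0 subr0; apply.
  + by apply: sumr_ge0 => S _; case: (HL S).
  + move=> i; apply: (@closed_comp _ _ (fun t : R => x + t *: e) (cover i)).
      by move=> t _; exact: ct.
    exact: cover_closed.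
  + by move=> t; exact: coverT.
  + move=> [T|] s t /=; last first.
      move=> ns nt; rewrite !W0// subrr normr0 mulr_ge0//.
      by apply: sumr_ge0 => S _; case: (HL S).
    case: ifP => // TT Ts Tt; rewrite !(WF _ _ TT)//.
    have -> : x + s *: e = (x + t *: e) + (s - t) *: e.
      by rewrite -addrA -scalerDl [t + _]addrC subrK.
    rewrite (le_trans ((HL T).2 _ _))// ler_wpM2r// (bigD1 T)//= lerDl.
    by apply: sumr_ge0 => S _; case: (HL S).
- apply: filterS ae_off_edges => x bx.
  suff [dW DWx] : derivable W x e /\ 'D_e W x = DW x.
    by rewrite -DWx; exact: derive_quotient_cvg.
  (* A point off the edges either lies outside the closure of Omega, where W vanishes nearby, or
     lies in an open triangle, because the hulls cover the closure. *)
  have [clx|nclx] := pselect (closure Omega x); last first.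
    have nK : ~ Omega x by move=> /subset_closure.
    have -> : DW x = 0 by rewrite /DW /A /B phiO// psiO// !mulr0 addr0.
    have nW : \forall y \near x, (0 : R) = W y.
      have : nbhs x (~` closure Omega).
        by apply: open_nbhs_nbhs; split => //; apply: closed_openC; exact: closed_closure.
      apply: (@filterS _ (nbhs x)) => y nyO; rewrite W0// => /subset_closure.
      exact.
    split.
      exact: (near_eq_derivable nW (derivable_cst (0 : R) x e)).
    by rewrite -(near_eq_derive e nW) derive_cst.
  have [T TT Tx] := closure_hull clx.
  have Ux : open_tri T x.
    move=> l lT; rewrite lt_neqAle eq_sym bx//=.
    by move/(hullE (tri_nondegenerate TT) (betaP TT)): Tx; apply.
  have nW : \forall y \near x, F T y = W y.
    have := open_tri_near TT Ux.
    by apply: (@filterS _ (nbhs x)) => y; rewrite /W /F => ->.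
  have [_ /(_ e)[dF _]] := CF T.
  split; first exact: near_eq_derivable nW (dF x).
  rewrite -(near_eq_derive e nW) DF /DW /A /B (piecewise_deriveE e TT Ux) (fP TT Tx).
  by rewrite addrC [X in X + _]mulrC.
move=> iDW; rewrite /DW RintegralD// => /eqP; rewrite addr_eq0 => /eqP BA.
rewrite [LHS]Rintegral_mkcond [X in - X]Rintegral_mkcond.
have -> : (fun x => f x * psi x) \_ Omega = A.
  apply/funext => x; rewrite patchE; case: ifPn => //.
  by rewrite notin_setE /A => /psiO ->; rewrite mulr0.
have -> : (fun x => piecewise_derive e x * phi x) \_ Omega = B.
  apply/funext => x; rewrite patchE; case: ifPn => //.
  by rewrite notin_setE /B => /phiO ->; rewrite mulr0.
by rewrite BA opprK.
Qed.

Lemma leb2_Omega_finite : (leb2 (Omega : set R2) < +oo)%E.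
Proof.
have [M OM] := bounded_set_box bO.
apply: le_lt_trans (box_finite M); apply: le_measure => //; rewrite inE.
- exact: open_measurable2.
- exact: measurable_box.
Qed.

Let L2_bounded (g : R2 -> R) C : measurable_fun Omega g ->
  (forall x, Omega x -> `|g x| <= C) -> L2 Omega g.
Proof.
move=> mg gC; split => //; apply: (bound_integrable (C := C ^+ 2)).
- exact: open_measurable2.
- exact: leb2_Omega_finite.
- exact: measurable_funX.
- by move=> x Ox; rewrite normrX lerXn2r// ?nnegrE// ?gC// (le_trans _ (gC _ Ox)).
Qed.

Lemma piecewise_H1 : H1 Omega f.
Proof.
exists (piecewise_derive e1, piecewise_derive e2); split => /=.
- have [C HC] := piecewise_bounded; apply: L2_bounded HC.
  exact: measurable_piecewise.
- have [C _ HC] := piecewise_derive_bounded e1; apply: L2_bounded HC.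
  apply: (@measurable_funS _ _ R2 _ setT) => //.
  exact: measurable_piecewise_derive.
- have [C _ HC] := piecewise_derive_bounded e2; apply: L2_bounded HC.
  apply: (@measurable_funS _ _ R2 _ setT) => //.
  exact: measurable_piecewise_derive.
- exact: piecewise_weak_derivative.
- exact: piecewise_weak_derivative.
Qed.

End PiecewisePolynomialH1.

Lemma piecewise_Pol_H1 (R : realType) (V : finType) (Omega : set (R * R))
    (Th : triangulation V Omega) (r : int) (f : R * R -> R) :
  polygonal_domain Omega ->
  (forall T, T \in tris Th -> Pol r (hull (pos Th) T) f) -> H1 Omega f.
Proof.
move=> hOmega Pf; have [beta Hb] := mesh_barycentric Th.
have /choice[P HP] : forall T, exists g, Cn 1 g /\ (T \in tris Th ->
    forall x, hull (pos Th) T x -> f x = g x).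
  move=> T; have [TT|_] := boolP (T \in tris Th).
    by have [g [_ Cg fg]] := Pol_extension (Pf _ TT); exists g.
  by exists (fun=> 0); split; [exact: Cn1_cst|].
apply: (piecewise_H1 Hb hOmega (P := P)); first by move=> T; case: (HP T).
by move=> T x TT; apply: (HP T).2.
Qed.

(** * Weighted projection onto a finite family through its Gram matrix *)

Section GramSolve.
Context d (T : measurableType d) (R : realType).
Variables (mu : {measure set T -> \bar R}) (D : set T).
Hypothesis mD : measurable D.
Local Notation itg f := (mu.-integrable D (EFin \o f)).

Lemma integrable_lincomb (I : Type) (r : seq I) (c : I -> R) (F : I -> T -> R) :
  (forall i, itg (F i)) ->
  itg (fun x => \sum_(i <- r) c i * F i x) /\
  \int[mu]_(x in D) (\sum_(i <- r) c i * F i x) =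
    \sum_(i <- r) c i * \int[mu]_(x in D) F i x.
Proof.
move=> iF; elim: r => [|a r [IH1 IH2]].
  have E : (fun x => \sum_(i <- [::]) c i * F i x) = (fun=> 0).
    by apply/funext => x; rewrite big_nil.
  rewrite E big_nil; split; first exact: integrable0.
  by rewrite Rintegral_cst// mul0r.
have E : (fun x => \sum_(i <- a :: r) c i * F i x) =
    (fun x => c a * F a x + \sum_(i <- r) c i * F i x).
  by apply/funext => x; rewrite big_cons.
have ia : itg (fun x => c a * F a x).
  by have := integrableZl mD (c a) (iF a); apply: eq_integrable.
rewrite E big_cons; split; last by rewrite RintegralD// RintegralZl// IH2.
by have := integrableD mD ia IH1; apply: eq_integrable.
Qed.

Variables (n : nat) (m : 'I_n -> T -> R) (b g : T -> R).
Hypotheses (ibm : forall i j, itg (fun x => b x * (m i x * m j x)))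
  (igm : forall i, itg (fun x => g x * m i x))
  (b0 : forall x, D x -> 0 <= b x)
  (bn0 : {ae mu, forall x, D x -> b x != 0}).

Let A : 'M[R]_n := \matrix_(i, j) \int[mu]_(x in D) (b x * (m i x * m j x)).
Let w : 'rV[R]_n := \row_j \int[mu]_(x in D) (g x * m j x).

Let quad (p q : 'I_n -> R) :
  itg (fun x => b x * ((\sum_i p i * m i x) * (\sum_j q j * m j x))) /\
  \int[mu]_(x in D) (b x * ((\sum_i p i * m i x) * (\sum_j q j * m j x))) =
  \sum_i p i * \sum_j q j * A i j.
Proof.
have H i := integrable_lincomb (index_enum _) q (ibm i).
have [iS eS] := integrable_lincomb (index_enum _) p (fun i => (H i).1).
have E : (fun x => b x * ((\sum_i p i * m i x) * (\sum_j q j * m j x))) =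
    (fun x => \sum_i p i * \sum_j q j * (b x * (m i x * m j x))).
  apply/funext => x; rewrite mulr_suml mulr_sumr; apply: eq_bigr => i _.
  rewrite !mulr_sumr; apply: eq_bigr => j _; ring.
rewrite E; split=> //; rewrite eS; apply: eq_bigr => i _; congr (_ * _).
by rewrite (H i).2; apply: eq_bigr => j _; rewrite mxE.
Qed.

Let lin (q : 'I_n -> R) :
  itg (fun x => g x * \sum_j q j * m j x) /\
  \int[mu]_(x in D) (g x * \sum_j q j * m j x) = \sum_j q j * w ord0 j.
Proof.
have [iS eS] := integrable_lincomb (index_enum _) q igm.
have E : (fun x => g x * \sum_j q j * m j x) =
    (fun x => \sum_j q j * (g x * m j x)).
  by apply/funext => x; rewrite mulr_sumr; apply: eq_bigr => i _; rewrite mulrCA.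
by rewrite E; split=> //; rewrite eS; apply: eq_bigr => i _; rewrite mxE.
Qed.

(* A vector in the kernel of the Gram matrix is a combination of the [m i] that
   vanishes almost everywhere, hence is orthogonal to [g]. *)
Let w_coker : w *m cokermx A = 0.
Proof.
apply/rowP => j; rewrite !mxE; pose y i := cokermx A i j.
have Ay i : \sum_l y l * A i l = 0.
  transitivity ((A *m cokermx A) i j); last by rewrite mulmx_coker mxE.
  by rewrite [RHS]mxE; apply: eq_bigr => l _; rewrite mulrC.
have [iq] := quad y y; rewrite (eq_bigr (fun=> 0)); last first.
  by move=> i _; rewrite Ay mulr0.
rewrite big1// => q0; have [il el] := lin y.
transitivity (\sum_i y i * w ord0 i); first by apply: eq_bigr => i _; rewrite mulrC.
rewrite -el; pose S x := \sum_i y i * m i x.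
(* The quadratic form of A at y is the integral of b * S^2. It is zero, the integrand is nonnegative
   and b is nonzero almost everywhere. *)
have S0 : {ae mu, forall x, D x -> S x = 0}.
  pose Q x := b x * (S x * S x).
  have mq : measurable_fun D (EFin \o Q) by exact: measurable_int iq.
  have /(ae_eq_integral_abs mu mD mq) : (\int[mu]_(x in D) `|(EFin \o Q) x| = 0)%E.
    rewrite (@eq_integral _ _ _ mu D (EFin \o Q)).
      by have /fineK <- := integrable_fin_num mD iq; congr EFin.
    move=> x; rewrite inE => Dx; rewrite gee0_abs// lee_fin.
    by rewrite mulr_ge0 ?b0// -expr2 sqr_ge0.
  apply: filterS2 bn0 => x bx + Dx => /(_ Dx)[] /eqP.
  by rewrite mulf_eq0 (negbTE (bx Dx)) /= mulf_eq0 orbb => /eqP.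
pose gS x := g x * S x.
have : (\int[mu]_(x in D) (EFin \o gS) x = \int[mu]_(x in D) 0)%E.
  apply: ae_eq_integral => //; first exact: measurable_int il.
  by apply: filterS S0 => x Sx Dx; rewrite /= /gS Sx// mulr0.
by rewrite integral0 /Rintegral => ->.
Qed.

(** By [w_coker] the vector w of the moments of g lies in the row space of A, even when the [m i]
    are dependent and A is singular. The coefficients of w in the rows are those of the
    projection. *)
Lemma gram_solve : exists q : 'I_n -> R, forall c : 'I_n -> R,
  \int[mu]_(x in D) ((b x * (\sum_i q i * m i x) - g x) * \sum_j c j * m j x) = 0.
Proof.
have /submxP[q wq] : (w <= A)%MS by rewrite submxE w_coker.
exists (q ord0) => c; have [iq eq] := quad (q ord0) c; have [il el] := lin c.
transitivity (\int[mu]_(x in D) (b x * ((\sum_i q ord0 i * m i x) * (\sum_j c j * m j x))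
   - g x * \sum_j c j * m j x)).
  by congr fine; apply: eq_integral => x _; congr EFin; ring.
rewrite RintegralB// eq el; apply/eqP; rewrite subr_eq0; apply/eqP.
under eq_bigr do rewrite mulr_sumr.
rewrite exchange_big; apply: eq_bigr => j _; rewrite wq mxE mulr_sumr.
by apply: eq_bigr => i _; rewrite mulrCA.
Qed.

End GramSolve.

Lemma Pol_span (R : realType) (r : nat) :
  exists n (m : 'I_n -> R * R -> R), (forall i, Pol r setT (m i)) /\
    forall D p, Pol r D p -> exists c : 'I_n -> R,
      forall x, D x -> p x = \sum_i c i * m i x.
Proof.
pose I := ('I_r.+1 * 'I_r.+1)%type.
(* Exponent pairs of too large degree are kept as zero functions, so that the full square of
   exponents is the index type. *)
pose m (a : I) (x : R * R) : R :=
  if (a.1 + a.2 <= r)%N then x.1 ^+ a.1 * x.2 ^+ a.2 else 0.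
exists #|{: I}|, (fun i => m (enum_val i)); split=> [i|D p [c pc]].
  have [ij|ij] := leqP ((enum_val i).1 + (enum_val i).2) r; last first.
    by apply: eq_Pol (Pol_cst r setT 0) => x _; rewrite /m leqNgt ij.
  have := PolM (PolX (enum_val i).1 (Pol_fst (setT : set (R * R)))) (PolX (enum_val i).2 (Pol_snd setT)).
  rewrite !muln1 => Pm; have := leq_Pol ij Pm.
  by apply: eq_Pol => x _; rewrite /m ij.
pose cI (a : I) := c a.1 a.2.
exists (fun i => cI (enum_val i)) => x /pc ->; rewrite absz_nat.
rewrite -(big_enum_val (fun a : I => cI a * m a x)) /=.
rewrite -(pair_bigA _ (fun i j : 'I_r.+1 => c i j * m (i, j) x)) /=.
apply: eq_bigr => i _; rewrite big_mkcond; apply: eq_bigr => j _.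
by rewrite lez_nat /m /=; case: ifP => _; rewrite ?mulrA ?mulr0.
Qed.

(** * Solvability of the systems for the middle and internal nodal values *)

Section InteriorValues.
Context {R : realType} {V : finType} {Omega : set (R * R)}.
Variables (Th : triangulation V Omega) (k : nat).
Hypothesis hOmega : polygonal_domain Omega.
Local Notation hull := (hull (pos Th)).
Implicit Types (S T : {set V}) (i j : multi_index (V := V) k) (f : R * R -> R).

(** The set from which [phi] is chosen contains the product of hat functions, by [lagrange_exists]
    and [piecewise_Pol_H1]. *)
Lemma phiP j : is_node Th j -> V0 Th k (phi Th j) /\
  forall i, is_node Th i -> phi Th j (node_pt Th i) = (i == j)%:R.
Proof.
move=> /exists_inP[T TT /andP[/eqP js _]].
have [f Pf fj] := lagrange_exists Th js.
apply: (@xgetPex _ (fun=> 0) [set f | V0 Th k f /\ forall i, is_node Th i ->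
  f (node_pt Th i) = (i == j)%:R]).
by exists f; split=> //; split=> //; exact: piecewise_Pol_H1 hOmega Pf.
Qed.

Lemma phi_Pol j T : is_node Th j -> T \in tris Th -> Pol k.+2 (hull T) (phi Th j).
Proof. by move=> /phiP[[_ +] _] TT; apply. Qed.

Lemma phi_node i j : is_node Th i -> is_node Th j ->
  phi Th j (node_pt Th i) = (i == j)%:R.
Proof. by move=> ni /phiP[_]; apply. Qed.

Lemma bounded_hull T : T \in tris Th -> bounded_set (hull T).
Proof.
move=> TT; have [_ _ _ bO _] := hOmega.
have [M OM] := bounded_set_box bO.
have cM : closed (box M : set (R * R)).
  by apply: compact_closed; [exact: norm_hausdorff|exact: compact_box].
have TM : hull T `<=` box M.
  apply: subset_trans cM; apply: subset_trans (closure_subset OM).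
  by rewrite (tri_cover Th) => x Tx; exists T.
exists M; split; first exact: num_real.
by move=> N MN x /TM/box_norm/le_trans; apply; exact: ltW.
Qed.

Definition bubble S (beta : V -> R * R -> R) x := \prod_(l in S) beta l x.

Lemma bubble_Pol S beta : (forall l, affine_fun (beta l)) ->
  Pol #|S| setT (bubble S beta).
Proof.
move=> ab; have P1 l : Pol 1 setT (beta l) by exact: affine_fun_Pol.
have := Pol_prod (enum S) P1; rewrite big_enum sum1_card.
by apply: eq_Pol => x _; rewrite big_enum.
Qed.

(* For a polynomial [q] the nodal values of [bubble * q] vanish at the nodes on
   the boundary of [S]; the Gram lemma with weight [bubble] provides [q]. *)
Lemma interior_values_exist d (X : measurableType d)
    (mu : {measure set X -> \bar R}) (D : set X) (gam : X -> R * R)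
    S T beta (r : nat) (g : X -> R) :
  T \in tris Th -> barycentric (pos Th) T beta -> S \subset T ->
  #|S| = 2%N \/ #|S| = 3%N -> (#|S| + r)%N = k.+2 ->
  measurable D -> (mu D < +oo)%E -> (forall x, D x -> hull S (gam x)) ->
  (forall f, continuous f -> measurable_fun D (f \o gam)) ->
  {ae mu, forall x, D x -> bubble S beta (gam x) != 0} ->
  mu.-integrable D (EFin \o g) ->
  exists a : multi_index (V := V) k -> R, forall p, Pol r (hull S) p ->
    \int[mu]_(x in D) ((\sum_(i | node_in S i && (supp i == S))
      a i * phi Th i (gam x) - g x) * p (gam x)) = 0.
Proof.
move=> TT bT ST Sc Sr mD Doo DS mgam b0 ig.
have [ab bT0 _ _] := bT.
have [n [m [mP span]]] := Pol_span R r.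
have Pcont (s : nat) f : Pol s setT f -> continuous f.
  move=> /Pol_extension[h [_ [ch _] fh]].
  by rewrite (_ : f = h)//; apply/funext => x; exact: fh.
have bP : Pol #|S| setT (bubble S beta) by exact: bubble_Pol.
have bounded f : continuous f -> exists C, forall x, D x -> `|f (gam x)| <= C.
  move=> cf; have [C _ HC] := continuous_bounded_on cf (bounded_hull TT).
  by exists C => x /DS/(sub_hull ST)/HC.
have := @gram_solve _ X R mu D mD n (fun (l : 'I_n) => m l \o gam) (bubble S beta \o gam) g.
move=> [].
- move=> i j; pose f x := bubble S beta x * (m i x * m j x).
  have cf : continuous f by exact: Pcont (PolM bP (PolM (mP i) (mP j))).
  have [C HC] := bounded _ cf.
  apply: (bound_integrable (C := C)) => //.
  exact: (mgam f cf).
- move=> i; have cm := Pcont _ _ (mP i).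
  have [C HC] := bounded _ cm.
  have := integrableMl mD ig (mgam _ cm) (bound_bounded HC).
  by apply: eq_integrable.
- move=> x /DS Sx; apply: prodr_ge0 => l _.
  by have /(hullE (tri_nondegenerate TT) bT) := sub_hull ST Sx; apply.
- exact: b0.
move=> q qP; pose Q x := \sum_i q i * m i x.
exists (fun i => bubble S beta (node_pt Th i) * Q (node_pt Th i)) => p Pp.
have [c pc] := span _ _ Pp.
rewrite -[RHS](qP c); congr fine; apply: eq_integral => x; rewrite inE => /DS Sx.
congr EFin; rewrite -pc//; congr (_ * _); congr (_ - _).
(* Here |S| + r = k + 2 enters: the product lies in the Lagrange space, so nodal interpolation
   reproduces it. *)
have PbQ : Pol k.+2 (hull S) (fun x => bubble S beta x * Q x).
  rewrite -Sr; apply: sub_Pol (@subsetT _ _) _; apply: PolM => //.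
  by apply: Pol_sum => i _; exact: PolZ.
have E := nodal_interpolation phi_Pol phi_node TT ST Sc PbQ Sx.
transitivity (bubble S beta (gam x) * Q (gam x)); last by [].
rewrite [RHS]E.
rewrite [RHS](bigID (fun i => supp i == S)) /= [X in _ + X]big1 ?addr0//.
move=> i /andP[iS sS]; rewrite (_ : bubble _ _ _ = 0) ?mul0r//.
(* A node of S whose support is smaller than S has a zero coordinate at some vertex of S, and that
   factor annihilates the bubble. *)
have [l lS il] : exists2 l, l \in S & i l = ord0.
  have /properP[_ [l lS]] : supp i \proper S.
    by rewrite finset.properEneq sS; case/andP: iS.
  by rewrite inE negbK => /eqP; exists l.
rewrite /bubble (bigD1 l)//= (barycentric_node l TT bT (node_inS ST iS)).
by rewrite il mul0r mul0r.
Qed.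

End InteriorValues.

(** * Integrability of H^1 functions and of traces *)

Section SquareIntegrable.
Context d (T : measurableType d) (R : realType).
Variables (mu : {measure set T -> \bar R}) (D : set T).

(** On a set of finite measure 1 + w^2 is an integrable majorant of |w|. *)
Lemma square_integrable_integrable (w : T -> R) :
  measurable D -> (mu D < +oo)%E -> measurable_fun D w ->
  mu.-integrable D (fun x => ((w x) ^+ 2)%:E) -> mu.-integrable D (EFin \o w).
Proof.
move=> mD Doo mw iw2.
have i1 : mu.-integrable D (EFin \o (fun=> 1 : R)).
  by apply: (bound_integrable (C := 1)) => // x _; rewrite normr1.
apply: le_integrable (integrableD mD i1 iw2) => //; first exact/measurable_EFinP.
move=> x Dx; rewrite /= lee_fin (ger0_norm (x := 1 + w x ^+ 2)) ?addr_ge0 ?sqr_ge0//.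
have [w0|w0] := leP 0 (w x).
  by rewrite ger0_norm//; have := sqr_ge0 (w x - 1); lra.
by rewrite ltr0_norm//; have := sqr_ge0 (w x + 1); lra.
Qed.

End SquareIntegrable.

Section Reflection.
Context {R : realType}.
Local Notation mu := (@lebesgue_measure R).
Local Notation I01 := (`[0%R, 1%R]%classic : set R).

(** Reverses an edge: [trace] may have been chosen for the endpoints in the order opposite to that
    of [enum]. *)
Definition reflect01 (t : R) : R := 1 - t.

Lemma measurable_reflect01 :
  measurable_fun (setT : set (measurableTypeR R)) (reflect01 : _ -> measurableTypeR R).
Proof. exact: measurable_funB. Qed.

Lemma lebesgue_measure_reflect01 (A : set R) : measurable A ->
  pushforward mu (reflect01 : _ -> measurableTypeR R) A = mu A.
Proof.
move=> mA; apply/esym/lebesgue_measure_unique => //=.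
  exact: measurable_reflect01.
move=> _ _ [[a b]] _ <-; rewrite /pushforward /=.
have -> : reflect01 @^-1` `]a, b] = `[1 - b, 1 - a[%classic.
  apply/seteqP; split=> x /=; rewrite /reflect01 !in_itv /= => /andP[? ?];
    by apply/andP; split; lra.
rewrite !lebesgue_measure_itv /= !lte_fin ltrD2l ltrN2; case: ifP => // _.
by rewrite -!EFinD; congr EFin; ring.
Qed.

Lemma integrable_reflect01 (f : R -> R) : mu.-integrable I01 (EFin \o f) ->
  mu.-integrable I01 (EFin \o (f \o reflect01)).
Proof.
move=> /integrableP[mf foo].
have rI : reflect01 @^-1` I01 = I01.
  apply/seteqP; split=> x /=; rewrite /reflect01 !in_itv /= => /andP[? ?];
    by apply/andP; split; lra.
apply/integrableP; split.
  apply: (measurable_comp (F := I01)) mf _ => //.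
    by move=> _ [x Ix <-]; rewrite -[I01]rI in Ix.
  exact: measurable_funTS measurable_reflect01.
pose F (x : measurableTypeR R) := `|(f x)%:E|%E.
have mF : measurable_fun I01 F by exact: measurableT_comp.
have H := @ge0_integral_pushforward _ _ (measurableTypeR R) (measurableTypeR R) R reflect01
  measurable_reflect01 mu I01 F (measurable_itv _) mF (fun _ _ => abse_ge0 _).
rewrite rI in H.
rewrite [X in (X < _)%E](_ : _ = \int[mu]_(x in I01) (F \o reflect01) x)%E//.
rewrite -H (_ : integral _ _ _ = \int[mu]_(x in I01) F x)%E//.
apply: eq_measure_integral => [|? A mA _]; first exact: measurable_reflect01.
exact: lebesgue_measure_reflect01.
Qed.

End Reflection.

(** * Restriction of the interpolant to simplices and the two mass identities *)

Section MassPreservation.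
Context {R : realType} {V : finType} {Omega : set (R * R)}.
Variables (Th : triangulation V Omega) (k : nat).
Hypothesis hOmega : polygonal_domain Omega.
Local Notation hull := (hull (pos Th)).
Local Notation mu := (@lebesgue_measure R).
Local Notation I01 := (`[0%R, 1%R]%classic : set R).
Local Notation R2 := (measurableTypeR R * measurableTypeR R)%type.
Implicit Types (E S T : {set V}) (i j : multi_index (V := V) k) (f p v : R * R -> R).

Lemma I01_finite : (mu I01 < +oo)%E.
Proof. by rewrite lebesgue_measure_itv /= lte_fin ltr01 -EFinB ltry. Qed.

(** Both outcomes of [xget] are integrable: a genuine trace is square integrable in one of the two
    orientations of the edge, and the default value is the zero function. *)
Lemma trace_integrable v E (a b : V) : E = [set a; b]%SET ->
  mu.-integrable I01 (EFin \o (trace Th v E \o seg_pt (pos Th a) (pos Th b))).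
Proof.
move=> Eab; rewrite /trace; case: xgetP => [w _|_]; last first.
  apply: (bound_integrable (C := 0)) => //.
  - exact: I01_finite.
  - exact: measurable_cst.
  - by move=> x _; rewrite /= normr0.
move=> [a' [b' [Eab' [mw w2 _]]]].
have iw : mu.-integrable I01 (EFin \o (w \o seg_pt (pos Th a') (pos Th b'))).
  by apply: square_integrable_integrable => //; exact: I01_finite.
have [[-> ->]//|[-> ->]] : (a = a' /\ b = b') \/ (a = b' /\ b = a').
  have aE : a \in [set a'; b']%SET by rewrite -Eab' Eab !inE eqxx.
  have bE : b \in [set a'; b']%SET by rewrite -Eab' Eab !inE eqxx orbT.
  have a'E : a' \in [set a; b]%SET by rewrite -Eab Eab' !inE eqxx.
  have b'E : b' \in [set a; b]%SET by rewrite -Eab Eab' !inE eqxx orbT.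
  move: aE bE a'E b'E; rewrite !inE => aE bE a'E b'E.
  have [aa'|naa'] := eqVneq a a'.
    left; split=> //; case/orP: bE => /eqP // ba'.
    by case/orP: b'E => /eqP ->//; rewrite ba' aa'.
  right; rewrite (negbTE naa') /= in aE; rewrite eq_sym (negbTE naa') /= in a'E.
  by rewrite (eqP aE) (eqP a'E).
have := integrable_reflect01 iw; apply: eq_integrable => //.
move=> t _ /=; congr (w _)%:E.
by rewrite /seg_pt /reflect01 opprB addrC subrKC.
Qed.

Lemma supp_neq0 S j : node_in S j -> (0 < #|supp j|)%N.
Proof.
move=> /andP[/eqP js _]; rewrite lt0n cards_eq0; apply: contra_eq_neq js => s0.
rewrite big1// => l _; have : l \notin supp j by rewrite s0 inE.
by rewrite inE negbK => /eqP ->.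
Qed.

Lemma edges_sub_tri E : E \in edges Th ->
  #|E| = 2%N /\ exists2 T, T \in tris Th & E \subset T.
Proof. by rewrite inE => /andP[/eqP ? /exists_inP[T ? ?]]; split=> //; exists T. Qed.

Lemma Pol_comp_integrable d (X : measurableType d) (m : {measure set X -> \bar R})
    (D : set X) (gam : X -> R * R) T S (r : nat) f :
  T \in tris Th -> S \subset T -> measurable D -> (m D < +oo)%E ->
  (forall x, D x -> hull S (gam x)) ->
  (forall f, continuous f -> measurable_fun D (f \o gam)) ->
  Pol r (hull S) f -> m.-integrable D (EFin \o (f \o gam)).
Proof.
move=> TT ST mD Doo DS mgam /Pol_extension[g [_ [cg _] fg]].
have [C _ HC] := continuous_bounded_on cg (bounded_hull hOmega TT).
have ig : m.-integrable D (EFin \o (g \o gam)).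
  apply: (bound_integrable (C := C)) => //; first exact: mgam.
  by move=> x /DS/(sub_hull ST)/HC.
by apply: eq_integrable ig => // x; rewrite inE => /DS/fg /= ->.
Qed.

Variables (C : multi_index (V := V) k -> {set V}) (v : R * R -> R).

Lemma Q0_Pol T : T \in tris Th -> Pol k.+2 (hull T) (Q0 Th C v).
Proof.
by move=> TT; apply: Pol_sum => j nj; apply: PolZ; exact: phi_Pol.
Qed.

Lemma Q0_V0 : V0 Th k (Q0 Th C v).
Proof. by split; [exact: piecewise_Pol_H1 hOmega Q0_Pol|exact: Q0_Pol]. Qed.

Lemma Q0_hull S T x : T \in tris Th -> S \subset T -> #|S| = 2%N \/ #|S| = 3%N ->
  hull S x -> Q0 Th C v x = \sum_(j | node_in S j) nodal_val Th C v j * phi Th j x.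
Proof.
move=> TT ST Sc Sx; rewrite /Q0 (bigID (node_in S)) /= [X in _ + X]big1 ?addr0.
  apply: eq_bigl => j; rewrite andbC; case jS : (node_in S j) => //=.
  exact: (node_in_is_node TT ST jS).
move=> j /andP[nj njS].
by rewrite (nodal_basis_eq0 (phi_Pol hOmega) (phi_node hOmega) TT ST)// mulr0.
Qed.

(** Brings the interpolant on E into the shape of the equation for [middle_sol]: a middle node has
    support E, so its value is read from the solution on this very edge. *)
Lemma Q0_edge E x : E \in edges Th -> hull E x -> Q0 Th C v x =
  \sum_(m | middle E m) middle_sol Th C v E m * phi Th m x +
  \sum_(c | corner E c) corner_val Th C v c * phi Th c x.
Proof.
move=> /edges_sub_tri[E2 [T TT ET]] Ex.
rewrite (Q0_hull TT ET (or_introl E2) Ex) (bigID (fun j => supp j == E)) /=.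
congr (_ + _).
  apply: eq_bigr => j /andP[_ /eqP sj].
  by rewrite /nodal_val /middle_val sj E2.
(* A nonempty support strictly contained in a pair of vertices is a singleton. *)
have cE j : node_in E j && (supp j != E) = corner E j.
  rewrite /corner; case jE : (node_in E j) => //=; have := supp_neq0 jE.
  case/andP: (jE) => _ sE; have := subset_leq_card sE; rewrite E2.
  have [->|nsE] := eqVneq (supp j) E; first by rewrite E2.
  have : supp j \proper E by rewrite finset.properEneq nsE.
  by move/proper_card; rewrite E2; case: #|supp j| => [|[|]].
rewrite (eq_bigl _ _ cE); apply: eq_bigr => j /andP[_ /eqP sj].
by rewrite /nodal_val sj.
Qed.

Lemma Q0_tri T x : T \in tris Th -> hull T x -> Q0 Th C v x =
  \sum_(i | internal T i) internal_sol Th C v T i * phi Th i x +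
  \sum_(m | node_in T m && (#|supp m| == 2%N)) middle_val Th C v m * phi Th m x +
  \sum_(c | corner T c) corner_val Th C v c * phi Th c x.
Proof.
move=> TT Tx; have T3 := card_tri TT.
rewrite (Q0_hull TT (fintype.subxx T) (or_intror T3) Tx).
rewrite (bigID (fun j => supp j == T)) /= -addrA; congr (_ + _).
  apply: eq_bigr => j /andP[_ /eqP sj].
  by rewrite /nodal_val /internal_val sj T3.
rewrite (bigID (fun j => #|supp j| == 2%N)) /=; congr (_ + _).
  apply: eq_big => [j|j /andP[_ /eqP s2]]; last by rewrite /nodal_val s2.
  case: (node_in T j) => //=; have [->|//] := eqVneq (supp j) T.
  by rewrite T3.
have cT j : node_in T j && (supp j != T) && (#|supp j| != 2%N) = corner T j.
  rewrite /corner; case jT : (node_in T j) => //=; have := supp_neq0 jT.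
  case/andP: (jT) => _ sT; have := subset_leq_card sT; rewrite T3.
  have [->|nsT] := eqVneq (supp j) T; first by rewrite T3.
  have : supp j \proper T by rewrite finset.properEneq nsT.
  by move/proper_card; rewrite T3; case: #|supp j| => [|[|[|]]].
rewrite (eq_bigl _ _ cT); apply: eq_bigr => j /andP[_ /eqP sj].
by rewrite /nodal_val sj.
Qed.

Lemma seg_pt_continuous (a b : R * R) : continuous (seg_pt a b).
Proof.
move=> t; apply: cvgD; apply: cvgZr_tmp; last exact: cvg_id.
by apply: cvgB; [exact: cvg_cst|exact: cvg_id].
Qed.

Lemma seg_pt_hull E (a b : V) t : enum E = [:: a; b] -> I01 t ->
  hull E (seg_pt (pos Th a) (pos Th b) t) /\
  forall T beta, T \in tris Th -> barycentric (pos Th) T beta -> E \subset T ->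
    bubble E beta (seg_pt (pos Th a) (pos Th b) t) = (1 - t) * t.
Proof.
move=> eE; rewrite /= in_itv /= => /andP[t0 t1].
have := enum_uniq E; rewrite eE /= inE andbT => ab.
have ba : b == a = false by rewrite eq_sym (negbTE ab).
pose l (u : V) := if u == a then 1 - t else if u == b then t else 0.
have sE (W : zmodType) (F : V -> W) : \sum_(i in E) F i = F a + F b.
  by rewrite -big_enum eE !big_cons big_nil /= addr0.
have la : l a = 1 - t by rewrite /l eqxx.
have lb : l b = t by rewrite /l ba eqxx.
have l1 : \sum_(i in E) l i = 1 by rewrite sE la lb subrK.
have lx : seg_pt (pos Th a) (pos Th b) t = \sum_(i in E) l i *: pos Th i.
  by rewrite sE la lb.
split.
  exists l; split=> // i; rewrite /l; do 2?case: ifP => _ //.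
  by rewrite subr_ge0.
move=> T beta TT bT ET; have H := barycentric_comb (tri_nondegenerate TT) bT ET l1 lx.
rewrite /bubble -big_enum eE !big_cons big_nil /= mulr1 !H.
have aE : a \in E by rewrite -mem_enum eE !inE eqxx.
have bE : b \in E by rewrite -mem_enum eE !inE eqxx orbT.
by rewrite aE bE la lb.
Qed.

Lemma edge_mass E p : E \in edges Th -> Pol k%:Z (hull E) p ->
  edge_int Th E (fun x => (trace Th v E x - Q0 Th C v x) * p x) = 0.
Proof.
move=> EE Pp; have [E2 [T TT ET]] := edges_sub_tri EE.
have [a [b eE]] : exists a b, enum E = [:: a; b].
  move: E2; rewrite cardE; case: (enum E) => [|a [|b []]]// _.
  by exists a, b.
have Eab : E = [set a; b]%SET.
  by apply/setP => l; rewrite -mem_enum eE !inE.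
pose gam := seg_pt (pos Th a) (pos Th b).
have [beta Hb] := mesh_barycentric Th; have bT := Hb _ TT.
have mI : measurable (I01 : set (measurableTypeR R)) by exact: measurable_itv.
have gE t : I01 t -> hull E (gam t) by move=> /(seg_pt_hull eE)[].
have mgam f : continuous f -> measurable_fun I01 (f \o gam).
  move=> cf; apply: measurable_funTS; apply: continuous_measurable_fun => t.
  by apply: continuous_comp; [exact: seg_pt_continuous|exact: cf].
pose cor (x : R * R) := \sum_(c | corner E c) corner_val Th C v c * phi Th c x.
have Pcor : Pol k.+2 (hull E) cor.
  apply: Pol_sum => j /andP[jE _]; apply: PolZ; apply: sub_Pol (sub_hull ET) _.
  by apply: phi_Pol => //; exact: (node_in_is_node TT ET jE).
have icor := @Pol_comp_integrable _ (measurableTypeR R) mu I01 gam T E k.+2 cor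
  TT ET mI I01_finite gE mgam Pcor.
have itr := trace_integrable v Eab.
(* The corner values are already fixed, so their contribution moves to the right-hand side. *)
pose g t := trace Th v E (gam t) - cor (gam t).
have ig : mu.-integrable I01 (EFin \o g).
  have := integrableB mI itr icor.
  by apply: eq_integrable.
(* Along the edge the bubble is (1 - t) t, which vanishes at the two endpoints only. *)
have b0 : {ae mu, forall t, I01 t -> bubble E (beta T) (gam t) != 0}.
  apply: (@negligibleS _ _ _ mu [set 0; 1]).
    move=> t /= nb; apply: contrapT => t01; apply: nb => It.
    have [_ /(_ _ _ TT bT ET) ->] := seg_pt_hull eE It.
    rewrite mulf_neq0 ?subr_eq0//; apply/eqP => H; apply: t01; [right|left] => //.
  have null (c : R) : mu.-negligible [set c].
    by apply/negligibleP; [exact: measurable_set1|exact: lebesgue_measure_set1].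
  exact: negligibleU.
have Ek : (#|E| + k)%N = k.+2 by rewrite E2.
have [sol Hsol] := @interior_values_exist _ _ _ Th k hOmega _ (measurableTypeR R)
  mu I01 gam E T (beta T) k g TT bT ET (or_introl E2) Ek mI
  I01_finite gE mgam b0 ig.
have Hmid : forall q, Pol k (hull E) q -> edge_int Th E (fun x =>
    (\sum_(m | middle E m) middle_sol Th C v E m * phi Th m x
     + \sum_(c | corner E c) corner_val Th C v c * phi Th c x
     - trace Th v E x) * q x) = 0.
  apply: (@xgetPex _ (fun=> 0) [set a | forall p, Pol k (hull E) p ->
    edge_int Th E (fun x =>
      (\sum_(m | middle E m) a m * phi Th m x
       + \sum_(c | corner E c) corner_val Th C v c * phi Th c x
       - trace Th v E x) * p x) = 0]).
  exists sol => q Pq; rewrite /edge_int eE /seg_int.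
  rewrite (_ : Rintegral _ _ _ = 0) ?mulr0//.
  rewrite -[RHS](Hsol q Pq); apply: eq_Rintegral => t _.
  by rewrite /g /cor; congr (_ * _); rewrite opprB addrA.
(* The defining equation carries the opposite sign, interpolant minus trace, so it is tested with
   -p. *)
rewrite -[RHS](Hmid _ (PolN Pp)) /edge_int eE /seg_int; congr (_ * _).
apply: eq_Rintegral => t; rewrite inE => It.
rewrite (Q0_edge EE (gE t It)) mulrN -mulNr; congr (_ * _).
by rewrite opprB.
Qed.

Hypothesis hv : H1 Omega v.

Lemma tri_mass T p : T \in tris Th -> Pol (k%:Z - 1) (hull T) p ->
  tri_int Th T (fun x => (v x - Q0 Th C v x) * p x) = 0.
Proof.
move=> TT Pp; have T3 := card_tri TT.
have intT : (hull T)° `<=` hull T by exact: interior_subset.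
(* For k = 0 the degree is -1: no pair satisfies i + j <= -1, so p is zero on T. Afterwards k - 1 is
   a natural number. *)
have [k0|k_gt0] := posnP k.
  rewrite /tri_int (@eq_Rintegral _ _ _ _ _ (fun=> 0)) => [|x].
    by rewrite /Rintegral integral0.
  rewrite inE => /intT Tx; have [c ->] := Pp; last exact: Tx.
  rewrite big1 ?mulr0// => i _; rewrite big1// => j.
  move=> ij; exfalso; lia.
have kE : k%:Z - 1 = k.-1%:Z by lia.
rewrite kE in Pp.
have [oO bO [OE _]] : [/\ open Omega, bounded_set Omega & (closure Omega)° = Omega /\ True].
  by case: hOmega => _ ? _ ? [? _].
(* Integrability of v is known on Omega only; that the interior of the closure is Omega itself keeps
   the open triangle inside. *)
have TO : (hull T)° `<=` Omega.
  have : (hull T)° `<=` (closure Omega)°.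
    by apply: interiorS; rewrite (tri_cover Th) => x Tx; exists T.
  by rewrite OE.
have mT : measurable ((hull T)° : set R2) by apply: open_measurable2; exact: open_interior.
have mO : measurable (Omega : set R2) by exact: open_measurable2.
have Ooo := leb2_Omega_finite hOmega.
have Too : (leb2 ((hull T)° : set R2) < +oo)%E.
  by apply: le_lt_trans Ooo; apply: le_measure => //; rewrite inE.
have [beta Hb] := mesh_barycentric Th; have bT := Hb _ TT.
have mid (f : R * R -> R) : continuous f -> measurable_fun ((hull T)° : set R2) (f \o id).
  move=> cf; apply: (@measurable_funS _ _ R2 _ setT) => //.
  exact: continuous_measurable2.
pose low (x : R * R) :=
  \sum_(m | node_in T m && (#|supp m| == 2%N)) middle_val Th C v m * phi Th m x +
  \sum_(c | corner T c) corner_val Th C v c * phi Th c x.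
have Plow : Pol k.+2 (hull T) low.
  by apply: PolD; apply: Pol_sum => j /andP[jT _]; apply: PolZ; apply: phi_Pol => //;
    exact: (node_in_is_node TT (fintype.subxx T) jT).
have ilow := @Pol_comp_integrable _ R2 leb2 (hull T)° id T T k.+2 low
  TT (fintype.subxx T) mT Too intT mid Plow.
have iv : leb2.-integrable ((hull T)° : set R2) (EFin \o v).
  have [G [[mv iv2] _ _ _ _]] := hv.
  apply: integrableS (square_integrable_integrable mO Ooo mv iv2) => //.
pose g x := v x - low x.
have ig : leb2.-integrable ((hull T)° : set R2) (EFin \o g).
  have := integrableB mT iv ilow.
  by apply: eq_integrable.
have b0 : {ae leb2, forall x : R2, (hull T)° x -> bubble T (beta T) x != 0}.
  apply: filterS (ae_off_edges Hb) => x bx _.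
  by apply/prodf_neq0 => l lT; exact: bx.
(* The cubic bubble leaves degree k - 1 for q, which is the degree of the test polynomials on T. *)
have Tk : (#|T| + k.-1)%N = k.+2 by rewrite T3; lia.
have [sol Hsol] := @interior_values_exist _ _ _ Th k hOmega _ R2
  leb2 (hull T)° id T T (beta T) k.-1 g TT bT (fintype.subxx T) (or_intror T3) Tk mT
  Too intT mid b0 ig.
have Hint : forall q, Pol (k%:Z - 1) (hull T) q -> tri_int Th T (fun x =>
    (\sum_(i | internal T i) internal_sol Th C v T i * phi Th i x
     + \sum_(m | node_in T m && (#|supp m| == 2%N)) middle_val Th C v m * phi Th m x
     + \sum_(c | corner T c) corner_val Th C v c * phi Th c x
     - v x) * q x) = 0.
  apply: (@xgetPex _ (fun=> 0) [set a | forall p, Pol (k%:Z - 1) (hull T) p ->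
    tri_int Th T (fun x =>
      (\sum_(i | internal T i) a i * phi Th i x
       + \sum_(m | node_in T m && (#|supp m| == 2%N)) middle_val Th C v m * phi Th m x
       + \sum_(c | corner T c) corner_val Th C v c * phi Th c x
       - v x) * p x) = 0]).
  exists sol => q; rewrite kE => Pq.
  rewrite -[RHS](Hsol q Pq); apply: eq_Rintegral => x _.
  by rewrite /g /low; congr (_ * _); rewrite opprB !addrA.
have Pp' := PolN Pp; rewrite -kE in Pp'.
rewrite -[RHS](Hint _ Pp'); apply: eq_Rintegral => x; rewrite inE => /intT Tx.
rewrite (Q0_tri TT Tx) mulrN -mulNr; congr (_ * _).
by rewrite opprB.
Qed.

End MassPreservation.

Theorem lemmaA2 (R : realType) (Omega : set (R * R)) (V : finType)
    (Th : triangulation V Omega) (k : nat) (C : multi_index k -> {set V})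
    (hOmega : polygonal_domain Omega) (hC : edge_selection Th C)
    (v : R * R -> R) (hv : H1 Omega v) :
  V0 Th k (Q0 Th C v) /\
  (forall (T : {set V}) (p : R * R -> R), T \in tris Th ->
     Pol (k%:Z - 1) (hull (pos Th) T) p ->
     tri_int Th T (fun x => (v x - Q0 Th C v x) * p x) = 0) /\
  (forall (E : {set V}) (p : R * R -> R), E \in edges Th ->
     Pol k%:Z (hull (pos Th) E) p ->
     edge_int Th E (fun x => (trace Th v E x - Q0 Th C v x) * p x) = 0).
Proof.
split; first exact: Q0_V0.
split=> [T p TT Pp|E p EE Pp]; first exact: tri_mass.
exact: edge_mass.
Qed.
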